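(* Let $d\ge 3$ be an odd integer. The rigid kernel of $G_d$ is (isomorphic to) the abelian group $$\prod_{k\ge 1}\mathcal{C}_{2^k}^{\,d^k-d^{k-1}},$$ where $\mathcal{C}_n$ is the cyclic group $\mathbb{Z}/n\mathbb{Z}$.
   Context: Let $d\ge 3$ be odd and $X=\{1,\dots,d\}$. Let $T$ be the $d$-regular rooted tree whose vertex set is the set $X^*$ of finite words over $X$, with root the empty word, the children of $u$ being $ux$, $x\in X$; $X^k$ is the $k$-th level. $\mathrm{Aut}(T)$ is the group of root-preserving graph automorphisms of $T$, with product $gh(u)=h(g(u))$ and identity $e$. For $g\in\mathrm{Aut}(T)$ and $u\in X^*$, the section $g|_u\in\mathrm{Aut}(T)$ is determined by $g(uv)=g(u)\,g|_u(v)$ for all $v\in X^*$. The wreath recursion of $g$ is $g=(g|_1,\dots,g|_d)\lambda_g$, where $\lambda_g\in S_d$ is the permutation induced by $g$ on $X$; it determines $g$. The group $G_d\le \mathrm{Aut}(T)$ is generated by $A=\{a_1,\dots,a_d\}$, defined recursively by: for $1\le i\le d-1$, $\lambda_{a_i}=(i\ \,i+1)$, $a_i|_i=a_i$, $a_i|_{i+1}=a_{i+1}$, and $a_i|_x=e$ for all other $x\in X$; and $\lambda_{a_d}=(d\ 1)$, $a_d|_1=a_1$, $a_d|_d=a_d$, and $a_d|_x=e$ for all other $x\in X$. For $G\le\mathrm{Aut}(T)$, $\mathrm{St}_{G}(\widehat{k})$ is the subgroup of elements of $G$ fixing every vertex of $X^k$. For a vertex $u$, $\mathrm{Rist}_{G}(u)$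 is the subgroup of elements of $G$ fixing every vertex not of the form $uv$ with $v\in X^*$; $\mathrm{Rist}_{G}(\widehat{k})$ is the subgroup generated by all $\mathrm{Rist}_{G}(u)$, $u\in X^k$. For a branch group $G$ (level-transitive with all $\mathrm{Rist}_G(\widehat{k})$ of finite index; $G_d$ is such a group), put $\overline{G}=\varprojlim_{k\ge1} G/\mathrm{St}_G(\widehat{k})$ and $\widetilde{G}=\varprojlim_{k\ge1} G/\mathrm{Rist}_G(\widehat{k})$. The rigid kernel of $G$ is the kernel of the natural surjection $\widetilde{G}\to\overline{G}$; it equals $\varprojlim_{k\ge 1}\mathrm{St}_G(\widehat{k})/\mathrm{Rist}_G(\widehat{k})$, the maps being induced by the inclusions $\mathrm{St}_G(\widehat{k+p})\hookrightarrow\mathrm{St}_G(\widehat{k})$ and $\mathrm{Rist}_G(\widehat{k+p})\hookrightarrow\mathrm{Rist}_G(\widehat{k})$. *)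

(* Defs.v *)
From HB Require Import structures.
From mathcomp Require Import all_boot perm zmodp.
From mathcomp Require Import boolp.

Set Implicit Arguments.
Unset Strict Implicit.
Unset Printing Implicit Defensive.

Local Open Scope group_scope.
Local Open Scope quotient_scope.

HB.factory Record isGroupClosed (gT : groupType) (S : {pred gT}) := {
  isGroupClosed_subproof : group_closed S
}.

HB.builders Context gT S of isGroupClosed gT S.

HB.instance Definition _ :=
  isMul1Closed.Build gT S (fst isGroupClosed_subproof).
HB.instance Definition _ :=
  isMulClosed.Build gT S (group_closedM isGroupClosed_subproof).
HB.instance Definition _ :=
  isInvClosed.Build gT S (group_closedV isGroupClosed_subproof).

HB.end.

HB.mixin Record isConjClosed (gT : groupType) (S : {pred gT}) := {
  gpredJr : forall x y : gT, x \in S -> x ^ y \in S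
}.

#[short(type="normalClosed")]
HB.structure Definition NormalClosed (gT : groupType) :=
  {S of isConjClosed gT S & GroupClosed gT S}.

Section Subgroup.

Variables (gT : groupType) (S : groupClosed gT).

Record subg := Subg {subg_val :> gT; subg_valP : subg_val \in S}.

HB.instance Definition _ := [isSub for subg_val].
HB.instance Definition _ := [Choice of subg by <:].

Lemma subg_closed : group_closed [in S].
Proof. by split=> [|x y xS yS]; rewrite ?gpred1 ?gpredF. Qed.

HB.instance Definition _ := SubChoice_isSubGroup.Build gT _ subg subg_closed.

End Subgroup.

Section Generated.

Variables (gT : groupType) (P : gT -> Prop).

Definition generated : {pred gT} :=
  fun x => `[< forall S : groupClosed gT, (forall y, P y -> y \in S) ->
                 x \in S >].

Lemma generatedP x :
  reflect (forall S : groupClosed gT, (forall y, P y -> y \in S) -> x \in S)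
          (x \in generated).
Proof. exact: asboolP. Qed.

Lemma mem_generated x : P x -> x \in generated.
Proof. by move=> Px; apply/generatedP => S; apply. Qed.

Lemma generated_closed : group_closed generated.
Proof.
split=> [|x y /generatedP xS /generatedP yS]; apply/generatedP => S PS.
  exact: gpred1.
by rewrite gpredF ?xS ?yS.
Qed.

HB.instance Definition _ := isGroupClosed.Build gT generated generated_closed.

End Generated.

Section Quotient.

Variables (gT : groupType) (N : normalClosed gT).

Definition coset_rel : rel gT := fun x y => x^-1 * y \in N.

Lemma coset_rel_equiv : equiv_class_of coset_rel.
Proof.
split=> [x|x y|y x z]; rewrite /coset_rel.
- by rewrite mulVg gpred1.
- by rewrite -gpredV invgM invgK.
- by move=> xy yz; rewrite -[z](mulVKg y) mulgA gpredM.
Qed.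

Canonical coset_equiv := EquivRelPack coset_rel_equiv.

Definition quot := {eq_quot coset_equiv}.

HB.instance Definition _ := Choice.on quot.
HB.instance Definition _ := EqQuotient.on quot.

Lemma quot_ex (a : quot) : exists x, a = \pi_quot x.
Proof. by exists (repr a); rewrite reprK. Qed.

Lemma quot_eqE (x y : gT) : (\pi_quot x == \pi_quot y) = (x^-1 * y \in N).
Proof. by rewrite piE. Qed.

Definition quot_one : quot := \pi_quot 1.
Definition quot_inv (a : quot) : quot := \pi_quot (repr a)^-1.
Definition quot_mul (a b : quot) : quot := \pi_quot (repr a * repr b).

Lemma repr_piP (x : gT) : x^-1 * repr (\pi_quot x) \in N.
Proof. by rewrite -quot_eqE reprK. Qed.

Lemma quot_invE x : quot_inv (\pi_quot x) = \pi_quot x^-1.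
Proof.
apply/eqP; rewrite /quot_inv quot_eqE invgK.
have := gpredJr _ x^-1 (repr_piP x).
by rewrite conjgE invgK !mulgA mulgV mul1g.
Qed.

Lemma quot_mulE x y :
  quot_mul (\pi_quot x) (\pi_quot y) = \pi_quot (x * y).
Proof.
apply/eqP; rewrite eq_sym /quot_mul quot_eqE invgM.
have Nx := gpredJr _ y (repr_piP x); have Ny := repr_piP y.
have -> : y^-1 * x^-1 * (repr (\pi_quot x) * repr (\pi_quot y)) =
          (x^-1 * repr (\pi_quot x)) ^ y * (y^-1 * repr (\pi_quot y)).
  by rewrite conjgE !mulgA mulgK.
exact: gpredM.
Qed.

Lemma quot_mulA : associative quot_mul.
Proof.
move=> a b c; have [x ->] := quot_ex a; have [y ->] := quot_ex b.
have [z ->] := quot_ex c.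
by rewrite !quot_mulE mulgA.
Qed.

Lemma quot_mul1g : left_id quot_one quot_mul.
Proof. by move=> a; have [x ->] := quot_ex a; rewrite quot_mulE mul1g. Qed.

Lemma quot_mulg1 : right_id quot_one quot_mul.
Proof. by move=> a; have [x ->] := quot_ex a; rewrite quot_mulE mulg1. Qed.

Lemma quot_mulVg : left_inverse quot_one quot_inv quot_mul.
Proof.
by move=> a; have [x ->] := quot_ex a; rewrite quot_invE quot_mulE mulVg.
Qed.

Lemma quot_mulgV : right_inverse quot_one quot_inv quot_mul.
Proof.
by move=> a; have [x ->] := quot_ex a; rewrite quot_invE quot_mulE mulgV.
Qed.

HB.instance Definition _ := isGroup.Build quot
  quot_mulA quot_mul1g quot_mulg1 quot_mulVg quot_mulgV.

End Quotient.

Section QuotientMap.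

Variables (gT : groupType) (N M : normalClosed gT) (sNM : {subset N <= M}).

Definition quot_map of {subset N <= M} : quot N -> quot M :=
  fun a => \pi_(quot M) (repr a).

Lemma quot_mapE (x : gT) :
  quot_map sNM (\pi_(quot N) x) = \pi_(quot M) x.
Proof. by apply/eqP; rewrite eq_sym quot_eqE sNM ?repr_piP. Qed.

Lemma quot_map_mul : {morph quot_map sNM : a b / a * b}.
Proof.
move=> a b; have [x ->] := quot_ex a; have [y ->] := quot_ex b.
rewrite [_ * _ in LHS]quot_mulE !quot_mapE.
by rewrite [RHS]quot_mulE.
Qed.

HB.instance Definition _ := isMultiplicative.Build _ _ (quot_map sNM)
  quot_map_mul.

End QuotientMap.

Section Product.

Variables (I : Type) (Q : I -> groupType).

Definition prodg := forall i : I, Q i.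

HB.instance Definition _ := Choice.on prodg.

Definition prodg_one : prodg := fun=> 1.
Definition prodg_inv (x : prodg) : prodg := fun i => (x i)^-1.
Definition prodg_mul (x y : prodg) : prodg := fun i => x i * y i.

Lemma prodg_mulA : associative prodg_mul.
Proof.
by move=> x y z; apply: functional_extensionality_dep=> i; apply: mulgA.
Qed.

Lemma prodg_mul1g : left_id prodg_one prodg_mul.
Proof.
by move=> x; apply: functional_extensionality_dep=> i; apply: mul1g.
Qed.

Lemma prodg_mulg1 : right_id prodg_one prodg_mul.
Proof.
by move=> x; apply: functional_extensionality_dep=> i; apply: mulg1.
Qed.

Lemma prodg_mulVg : left_inverse prodg_one prodg_inv prodg_mul.
Proof.
by move=> x; apply: functional_extensionality_dep=> i; apply: mulVg.
Qed.

Lemma prodg_mulgV : right_inverse prodg_one prodg_inv prodg_mul.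
Proof.
by move=> x; apply: functional_extensionality_dep=> i; apply: mulgV.
Qed.

HB.instance Definition _ := isGroup.Build prodg
  prodg_mulA prodg_mul1g prodg_mulg1 prodg_mulVg prodg_mulgV.

End Product.

Lemma gmulf1g (gT rT : groupType) (f : {multiplicative gT -> rT}) : f 1 = 1.
Proof. by apply: (mulIg (f 1)); rewrite -gmulfM !mul1g. Qed.

Lemma gmulfVg (gT rT : groupType) (f : {multiplicative gT -> rT}) x :
  f x^-1 = (f x)^-1.
Proof. by apply: (mulIg (f x)); rewrite -gmulfM !mulVg gmulf1g. Qed.

Section InverseLimit.

Variables (Q : nat -> groupType) (f : forall k, {multiplicative Q k.+1 -> Q k}).

Definition coherent : {pred prodg Q} :=
  fun x => `[< forall k, f k (x k.+1) = x k >].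

Lemma coherent_closed : group_closed coherent.
Proof.
split=> [|x y /asboolP xf /asboolP yf]; apply/asboolP => k.
  exact: gmulf1g.
by rewrite [LHS]gmulfM gmulfVg xf yf.
Qed.

HB.instance Definition _ := isGroupClosed.Build _ coherent coherent_closed.

Definition invlim := subg coherent.

HB.instance Definition _ := Group.on invlim.

End InverseLimit.

Section InverseLimitMap.

Variables (Q P : nat -> groupType).
Variables (f : forall k, {multiplicative Q k.+1 -> Q k}).
Variables (g : forall k, {multiplicative P k.+1 -> P k}).
Variables (h : forall k, {multiplicative Q k -> P k}).
Hypothesis hfg : forall k x, g k (h k.+1 x) = h k (f k x).

Lemma invlim_map_subproof (x : invlim f) :
  ((fun k => h k (val x k)) : prodg P) \in coherent g.
Proof.
by apply/asboolP => k; rewrite hfg; have /asboolP -> := valP x.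
Qed.

Definition invlim_map (x : invlim f) : invlim g :=
  Subg (invlim_map_subproof x).

Lemma invlim_map_mul : {morph invlim_map : x y / x * y}.
Proof.
move=> x y; apply: val_inj; apply: functional_extensionality_dep=> k.
exact: gmulfM.
Qed.

HB.instance Definition _ := isMultiplicative.Build _ _ invlim_map
  invlim_map_mul.

End InverseLimitMap.

Section Kernel.

Variables (gT rT : groupType) (f : {multiplicative gT -> rT}).

Definition kernel : {pred gT} := fun x => f x == 1.

Lemma kernel_closed : group_closed kernel.
Proof.
split=> [|x y /eqP fx /eqP fy]; apply/eqP; first exact: gmulf1g.
by rewrite gmulfM gmulfVg fx fy mulgV.
Qed.

HB.instance Definition _ := isGroupClosed.Build _ kernel kernel_closed.

End Kernel.

Definition isomorphic (gT rT : groupType) : Prop :=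
  exists f : {multiplicative gT -> rT}, bijective f.

Section Tree.

Variable d : nat.

(* The letter x of {1, ..., d} is the ordinal x - 1.                          *)
Definition word := seq 'I_d.

Definition adjacent (u v : word) : Prop :=
  exists x : 'I_d, v = rcons u x \/ u = rcons v x.

Definition is_tree_aut (f : word -> word) : Prop :=
  [/\ bijective f, f [::] = [::]
    & forall u v, adjacent (f u) (f v) <-> adjacent u v].

Record tree_aut := TreeAut {
  tree_fun :> word -> word;
  tree_funP : `[< is_tree_aut tree_fun >]
}.

HB.instance Definition _ := [isSub for tree_fun].
HB.instance Definition _ := [Choice of tree_aut by <:].

Lemma tree_autP (g : tree_aut) : is_tree_aut g.
Proof. exact/asboolP/tree_funP. Qed.

Lemma tree_autE (g h : tree_aut) : g =1 h -> g = h.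
Proof. by move=> gh; apply/val_inj/funext. Qed.

Lemma tree_one_subproof : `[< is_tree_aut idfun >].
Proof. by apply/asboolP; split=> //; exists idfun. Qed.

Definition tree_one := TreeAut tree_one_subproof.

Lemma tree_mul_subproof (g h : tree_aut) : `[< is_tree_aut (h \o g) >].
Proof.
have [bg g0 ag] := tree_autP g; have [bh h0 ah] := tree_autP h.
apply/asboolP; split; [exact: bij_comp | by rewrite /= g0 |].
by move=> u v; rewrite /= ah.
Qed.

(* g * h acts as g first and then h, as for the permutations of perm.v.       *)
Definition tree_mul (g h : tree_aut) := TreeAut (tree_mul_subproof g h).

Lemma tree_inv_subproof (g : tree_aut) :
  exists f : word -> word,
    [/\ cancel g f, cancel f g & `[< is_tree_aut f >]].
Proof.
have [[f gK fK] g0 ag] := tree_autP g; exists f; split=> //.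
apply/asboolP; split; [by exists g | by rewrite -[in LHS]g0 gK |].
by move=> u v; rewrite -ag !fK.
Qed.

Definition tree_inv (g : tree_aut) : tree_aut :=
  let: exist _ (And3 _ _ fP) := cid (tree_inv_subproof g) in TreeAut fP.

Lemma tree_invK (g : tree_aut) : cancel g (tree_inv g).
Proof. by rewrite /tree_inv; case: cid => f []. Qed.

Lemma tree_invKV (g : tree_aut) : cancel (tree_inv g) g.
Proof. by rewrite /tree_inv; case: cid => f []. Qed.

Lemma tree_mulA : associative tree_mul.
Proof. by move=> g h k; apply: tree_autE. Qed.

Lemma tree_mul1g : left_id tree_one tree_mul.
Proof. by move=> g; apply: tree_autE. Qed.

Lemma tree_mulg1 : right_id tree_one tree_mul.
Proof. by move=> g; apply: tree_autE. Qed.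

Lemma tree_mulVg : left_inverse tree_one tree_inv tree_mul.
Proof. by move=> g; apply: tree_autE => u; apply: tree_invKV. Qed.

Lemma tree_mulgV : right_inverse tree_one tree_inv tree_mul.
Proof. by move=> g; apply: tree_autE => u; apply: tree_invK. Qed.

HB.instance Definition _ := isGroup.Build tree_aut
  tree_mulA tree_mul1g tree_mulg1 tree_mulVg tree_mulgV.

Lemma tree_aut1E u : (1 : tree_aut) u = u. Proof. by []. Qed.

Lemma tree_autM (g h : tree_aut) u : (g * h) u = h (g u). Proof. by []. Qed.

Lemma tree_autK (g : tree_aut) : cancel g g^-1.
Proof. exact: tree_invK. Qed.

Lemma tree_autKV (g : tree_aut) : cancel g^-1 g.
Proof. exact: tree_invKV. Qed.

Lemma tree_aut_inj (g : tree_aut) : injective g.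
Proof. exact: can_inj (tree_autK g). Qed.

Lemma tree_aut_nil (g : tree_aut) : g [::] = [::].
Proof. by have [] := tree_autP g. Qed.

Lemma tree_aut_rcons (g : tree_aut) u x :
  exists y, g (rcons u x) = rcons (g u) y.
Proof.
have [_ g0 ag] := tree_autP g.
elim/last_ind: u x => [|u z IHu] x; set v := rcons _ _.
  have /ag[y [|]] : adjacent [::] v by exists x; left.
    by exists y.
  by rewrite g0; case: (g v).
have /ag[y [->|]] : adjacent (rcons u z) v by exists x; left.
  by exists y.
have [t ->] := IHu z => /rcons_inj[/tree_aut_inj uv _].
have := congr1 size uv; rewrite /v !size_rcons => /eqP.
by rewrite -addn2 -{1}[size u]addn0 eqn_add2l.
Qed.

Lemma size_tree_aut (g : tree_aut) u : size (g u) = size u.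
Proof.
elim/last_ind: u => [|u x IHu]; first by rewrite tree_aut_nil.
by have [y ->] := tree_aut_rcons g u x; rewrite !size_rcons IHu.
Qed.

Lemma prefix_tree_aut (g : tree_aut) u v : prefix (g u) (g v) = prefix u v.
Proof.
have pg (h : tree_aut) w t : prefix w t -> prefix (h w) (h t).
  move=> /prefixP[s ->]; elim/last_ind: s => [|s x IHs].
    by rewrite cats0 prefix_refl.
  rewrite -rcons_cat; have [y ->] := tree_aut_rcons h (w ++ s) x.
  by apply: prefix_trans IHs _; rewrite prefix_rcons.
by apply/idP/idP => [/(pg g^-1)|/pg//]; rewrite !tree_autK.
Qed.

Section Stabilizers.

Variable G : groupClosed tree_aut.

Definition level_stab (k : nat) : {pred subg G} :=
  fun g => `[< forall u : word, size u = k -> val g u = u >].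

Definition rist (u : word) : {pred subg G} :=
  fun g => `[< forall w : word, ~~ prefix u w -> val g w = w >].

Definition level_rist (k : nat) : {pred subg G} :=
  generated (fun g => exists2 u : word, size u = k & g \in rist u).

Lemma subg_fix1 u : val (1 : subg G) u = u.
Proof. by []. Qed.

Lemma subg_fixF (g h : subg G) u : val g u = u -> val h u = u ->
  val (g / h) u = u.
Proof.
move=> gu hu; have -> : val (g / h) = val g * (val h)^-1 by [].
by rewrite tree_autM gu -[in LHS]hu tree_autK.
Qed.

Lemma subg_conjE (g h : subg G) u :
  val (g ^ h) u = val h (val g ((val h)^-1 u)).
Proof. by []. Qed.

Lemma level_stab_closed k : group_closed (level_stab k).
Proof.
split=> [|g h /asboolP gk /asboolP hk]; apply/asboolP => u uk.
  exact: subg_fix1.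
by rewrite subg_fixF ?gk ?hk.
Qed.

HB.instance Definition _ k :=
  isGroupClosed.Build (subg G) (level_stab k) (level_stab_closed k).

Lemma level_stab_conj k (g h : subg G) :
  g \in level_stab k -> g ^ h \in level_stab k.
Proof.
move=> /asboolP gk; apply/asboolP => u uk.
by rewrite subg_conjE gk ?size_tree_aut// tree_autKV.
Qed.

HB.instance Definition _ k :=
  isConjClosed.Build (subg G) (level_stab k) (@level_stab_conj k).

Lemma rist_closed u : group_closed (rist u).
Proof.
split=> [|g h /asboolP gu /asboolP hu]; apply/asboolP => w uw.
  exact: subg_fix1.
by rewrite subg_fixF ?gu ?hu.
Qed.

HB.instance Definition _ u :=
  isGroupClosed.Build (subg G) (rist u) (rist_closed u).

Lemma rist_conj u (g h : subg G) : g \in rist u -> g ^ h \in rist (val h u).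
Proof.
move=> /asboolP gu; apply/asboolP => w uw.
rewrite subg_conjE gu ?tree_autKV//.
by rewrite -(prefix_tree_aut (val h)) tree_autKV.
Qed.

HB.instance Definition _ k := GroupClosed.on (level_rist k).

Lemma generated_conj (gT : groupType) (P : gT -> Prop) (h : gT) :
  (forall g, P g -> P (g ^ h)) ->
  forall g, g \in generated P -> g ^ h \in generated P.
Proof.
move=> Ph g /generatedP gP; apply/generatedP => S PS.
pose S' : {pred gT} := fun x => x ^ h \in S.
have inS' x : (x \in S') = (x ^ h \in S) by [].
have S'P : group_closed S'.
  split=> [|x y]; rewrite !inS' ?conj1g ?gpred1 // => xS yS.
  by rewrite conjMg conjVg gpredF.
pose S'' := HB.pack_for (groupClosed gT) S' (isGroupClosed.Build gT S' S'P).
by apply: (gP S'') => y Py; apply/PS/Ph.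
Qed.

Lemma level_rist_conj k (g h : subg G) :
  g \in level_rist k -> g ^ h \in level_rist k.
Proof.
apply: generated_conj => {}g [u uk gu].
by exists (val h u); [rewrite size_tree_aut | apply: rist_conj].
Qed.

HB.instance Definition _ k :=
  isConjClosed.Build (subg G) (level_rist k) (@level_rist_conj k).

Lemma level_stabS k : {subset level_stab k.+1 <= level_stab k}.
Proof.
move=> g /asboolP gk; apply/asboolP => u uk.
case: u uk => [|x u] uk; first exact: tree_aut_nil.
have := gk (rcons (x :: u) x); rewrite size_rcons uk => /(_ erefl).
by have [y ->] := tree_aut_rcons (val g) (x :: u) x => /rcons_inj[->].
Qed.

Lemma rist_rcons u x : {subset rist (rcons u x) <= rist u}.
Proof.
move=> g /asboolP gu; apply/asboolP => w uw; apply: gu.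
by apply: contraNN uw; apply: prefix_trans; apply: prefix_rcons.
Qed.

Lemma level_ristS k : {subset level_rist k.+1 <= level_rist k}.
Proof.
move=> g /generatedP gk; apply: gk => h [u uk hu].
case/lastP: u uk hu => [//|u x]; rewrite size_rcons => -[uk] hu.
by apply: mem_generated; exists u => //; apply: rist_rcons hu.
Qed.

Lemma level_rist_stab k : {subset level_rist k <= level_stab k}.
Proof.
move=> g /generatedP gk; apply: gk => h [u uk /asboolP hu].
have h_fix w : size w = k -> w != u -> val h w = w.
  move=> wk wu; apply: hu; apply: contraNN wu => /prefixP[s ws].
  move: wk; rewrite ws size_cat uk -[RHS]addn0 => /addnI/size0nil->.
  by rewrite cats0.
apply/asboolP => w wk; have [->|/h_fix->//] := eqVneq w u.
have [//|/h_fix huu] := eqVneq (val h u) u.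
by apply: (tree_aut_inj (g := val h)); rewrite huu ?size_tree_aut.
Qed.

(* The limits are over the levels k.+1 for k : nat.                           *)
Definition rist_quot k : groupType := quot (level_rist k.+1).
Definition stab_quot k : groupType := quot (level_stab k.+1).

Definition rist_step k : {multiplicative rist_quot k.+1 -> rist_quot k} :=
  quot_map (@level_ristS k.+1).
Definition stab_step k : {multiplicative stab_quot k.+1 -> stab_quot k} :=
  quot_map (@level_stabS k.+1).
Definition rist_to_stab k : {multiplicative rist_quot k -> stab_quot k} :=
  quot_map (@level_rist_stab k.+1).

Definition rist_completion : groupType := invlim rist_step.
Definition stab_completion : groupType := invlim stab_step.

Lemma rist_to_stab_step k (a : rist_quot k.+1) :
  stab_step k (rist_to_stab k.+1 a) = rist_to_stab k (rist_step k a).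
Proof. by have [x ->] := quot_ex a; rewrite /= !quot_mapE. Qed.

Definition completion_map :
  {multiplicative rist_completion -> stab_completion} :=
  invlim_map rist_to_stab_step.

Definition rigid_kernel : groupType := subg (kernel completion_map).

End Stabilizers.

(* a_i permutes the letters by (i i+1), and its sections are                  *)
(*   a_i|_i = a_i, a_i|_(i+1) = a_(i+1), a_i|_x = e for the other letters,    *)
(* where i + 1 is ordS i, i.e., taken modulo d, which covers the case i = d.  *)
Fixpoint gen_fun (i : 'I_d) (u : word) : word :=
  if u is x :: v then
    tperm i (ordS i) x ::
      (if x == i then gen_fun i v
       else if x == ordS i then gen_fun (ordS i) v
       else v)
  else [::].

Fixpoint gen_inv_fun (i : 'I_d) (u : word) : word :=
  if u is y :: v then
    let x := tperm i (ordS i) y in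
    x :: (if x == i then gen_inv_fun i v
          else if x == ordS i then gen_inv_fun (ordS i) v
          else v)
  else [::].

Lemma gen_funK i : cancel (gen_fun i) (gen_inv_fun i).
Proof.
move=> u; elim: u i => //= x u IHu i; rewrite tpermK; congr (_ :: _).
by case: (x == i) => //; case: (x == ordS i).
Qed.

Lemma gen_inv_funK i : cancel (gen_inv_fun i) (gen_fun i).
Proof.
move=> u; elim: u i => //= y u IHu i; rewrite tpermK; congr (_ :: _).
by case: (_ == i) => //; case: (_ == ordS i).
Qed.

Lemma gen_fun_rcons i u x :
  exists y, gen_fun i (rcons u x) = rcons (gen_fun i u) y.
Proof.
elim: u i => [|z u IHu] i /=.
  by exists (tperm i (ordS i) x); case: ifP => // _; case: ifP.
have [[y ->] [t ->]] := (IHu i, IHu (ordS i)).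
by case: ifP => _; [exists y | case: ifP => _; [exists t | exists x]].
Qed.

Lemma gen_inv_fun_rcons i u x :
  exists y, gen_inv_fun i (rcons u x) = rcons (gen_inv_fun i u) y.
Proof.
elim: u i => [|z u IHu] i /=.
  by exists (tperm i (ordS i) x); case: ifP => // _; case: ifP.
have [[y ->] [t ->]] := (IHu i, IHu (ordS i)).
by case: ifP => _; [exists y | case: ifP => _; [exists t | exists x]].
Qed.

Lemma adjacent_morph (f : word -> word) :
  (forall u x, exists y, f (rcons u x) = rcons (f u) y) ->
  forall u v, adjacent u v -> adjacent (f u) (f v).
Proof.
move=> f_rcons u v [x [->|->]].
  by have [y ->] := f_rcons u x; exists y; left.
by have [y ->] := f_rcons v x; exists y; right.
Qed.

Lemma gen_fun_subproof i : `[< is_tree_aut (gen_fun i) >].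
Proof.
apply/asboolP; split=> [|//|u v].
  by exists (gen_inv_fun i); [apply: gen_funK | apply: gen_inv_funK].
split; last exact/adjacent_morph/gen_fun_rcons.
by move=> /(adjacent_morph (gen_inv_fun_rcons i)); rewrite !gen_funK.
Qed.

Definition gen i : tree_aut := TreeAut (gen_fun_subproof i).

Definition is_section (g : tree_aut) (u : word) (h : tree_aut) : Prop :=
  forall v : word, g (u ++ v) = g u ++ h v.

Lemma gen_section i x :
  is_section (gen i) [:: x]
    (if x == i then gen i else if x == ordS i then gen (ordS i) else 1).
Proof. by move=> v /=; case: ifP => _ //; case: ifP. Qed.

Definition Gd : {pred tree_aut} :=
  generated (fun g => exists i, g = gen i).

HB.instance Definition _ := GroupClosed.on Gd.

End Tree.

(* Main.v *)
From HB Require Import structures.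
Require Import Defs.
From mathcomp Require Import all_boot all_algebra perm zmodp boolp.
From mathcomp Require Import zify ring.

Set Implicit Arguments.
Unset Strict Implicit.
Unset Printing Implicit Defensive.

Import GRing.Theory.

Local Open Scope group_scope.
Local Open Scope quotient_scope.

(** Write G for the group and e for the exponent sum, the number of generators
    minus the number of inverses of generators in a word.

    Everything rests on e. It is a homomorphism from G to the integers
    ([relator_wexp0]: a word that is trivial in G has exponent sum 0, because a
    shortest counterexample could not have shorter sections). Each generator
    moves two letters and acquires one generator at each of them, so the
    exponent sums of the sections of g at the children of a vertex u add up to
    twice the exponent sum of the section at u ([sum_expo_sec]); and g permutes
    the first level with the parity of e(g), so that e(g) is even as soon as g
    fixes that level ([expo_even]).

    For odd d these are the only constraints ([realizable_sum_mod4]): elements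
    f x of G are the sections of an element of G fixing the first level as soon
    as the sum of the e(f x) is divisible by 4. This has two halves. First,
    G contains the kernel of e placed on any single subtree of the first level
    ([realizable_expo0]): the set of the s that can be placed on the subtree at
    x does not depend on x and is normal in G, since some element of G sends the
    subtree at x to the subtree at x + 2 without twisting it and steps of two
    visit all letters when d is odd; and the braid word in two neighbouring
    generators is supported on one subtree, which identifies all generators
    modulo that normal subgroup. Second, only the vector of the exponent sums of
    the sections matters now, that is the image of G in the wreath product of Z
    by the symmetric group; computing there, all vectors of sum 0 modulo 4 are
    reached ([pure_sum_mod4]).

    It follows by induction on the level that an element of the stabilizer of
    level k >= 1 is in the rigid stabilizer of level k if and only if 2^(k+1)
    divides the exponent sums n_u of its sections at all the vertices u of that
    level ([level_ristP]). Hence a point of the rigid kernel is a family of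
    n_u modulo 2^(|u|+1), where the sum of n_(ux) over the letters x is
    2 n_u. The n_u are even, because the element can be taken in the stabilizer
    of a deeper level. With n_u = 2 m_u, the m_u at the children of a vertex of
    level k are residues modulo 2^(k+1), and their sum is prescribed to be
    twice the m of the parent; so one of them is determined by the others and by
    the parent, and the others, d^k (d - 1) of them on level k + 1, are free.
    They are the coordinates of the isomorphism ([coord]). *)

(** * The cycle of letters, and words in the generators *)

Section Cycle.

Variable d : nat.
Implicit Types x y : 'I_d.

Lemma iter_ordS_val n x : nat_of_ord (iter n (@ordS d) x) = (x + n) %% d.
Proof.
elim: n => [|n IHn]; first by rewrite addn0 modn_small.
by rewrite /= IHn addnS -[(_ %% d).+1]addn1 -[(x + n).+1]addn1 modnDml.
Qed.

Lemma iter_ordS_inj n m x : n < d -> m < d ->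
  iter n (@ordS d) x = iter m (@ordS d) x -> n = m.
Proof.
move=> nd md /(congr1 (@nat_of_ord d)); rewrite !iter_ordS_val => /eqP.
by rewrite eqn_modDl !modn_small // => /eqP.
Qed.

Lemma ordS_ind (P : 'I_d -> Prop) x :
  P x -> (forall y, P y -> P (ordS y)) -> forall y, P y.
Proof.
move=> Px PS y; suff -> : y = iter (y + (d - x)) (@ordS d) x.
  by elim: (_ + _) => //= n; apply: PS.
apply: ord_inj; rewrite iter_ordS_val.
have -> : x + (y + (d - x)) = y + d by have := ltn_ord x; lia.
by rewrite modnDr modn_small.
Qed.

(** As d is odd, the successor is the (d + 1) / 2-th power of the double
    step. *)
Lemma ordSS_ind (P : 'I_d -> Prop) x :
  odd d -> P x -> (forall y, P y -> P (ordS (ordS y))) -> forall y, P y.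
Proof.
move=> d_odd Px PS; have Peven n y : P y -> P (iter n.*2 (@ordS d) y).
  by elim: n => //= n IHn Py; apply/PS/IHn.
apply: (ordS_ind Px) => y Py.
have -> : ordS y = iter (d.+1./2).*2 (@ordS d) y.
  apply: ord_inj; have -> : (d.+1./2).*2 = d + 1 by lia.
  by rewrite iter_ordS_val addnCA modnDl addn1.
exact: Peven.
Qed.

Hypothesis d_ge3 : 3 <= d.

Lemma ordS_neq x : (ordS x == x) = false.
Proof.
apply/eqP => xS; have : 1%N = 0; last by [].
by apply: (@iter_ordS_inj _ _ x) => //; lia.
Qed.

Lemma ordSS_neq x : (ordS (ordS x) == x) = false.
Proof.
apply/eqP => xS; have : 2 = 0; last by [].
by apply: (@iter_ordS_inj _ _ x) => //; lia.
Qed.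

End Cycle.

Section Words.

Variable d : nat.

Local Notation letter := ('I_d * bool)%type.
Local Notation gword := (seq letter).
Implicit Types (l : letter) (w : gword) (x y : 'I_d).

Definition lval l : tree_aut d := if l.2 then gen l.1 else (gen l.1)^-1.
Definition wval w : tree_aut d := foldr (fun l g => lval l * g) 1 w.

Definition lperm l : 'S_d := tperm l.1 (ordS l.1).
Definition wperm w : 'S_d := foldr (fun l s => lperm l * s) 1 w.

(** Since gen i has section gen x at both letters x that it moves, the index of
    the section is the moved letter itself, or its image for an inverse. *)
Definition lsec l x : gword :=
  if (x == l.1) || (x == ordS l.1)
  then [:: (if l.2 then x else lperm l x, l.2)] else [::].
Fixpoint wsec w x : gword :=
  if w is l :: w' then lsec l x ++ wsec w' (lperm l x) else [::].

Definition lexp l : int := (if l.2 then 1 else -1)%R.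
Definition wexp w : int := (\sum_(l <- w) lexp l)%R.

Definition winv w : gword := rev [seq (l.1, ~~ l.2) | l <- w].

Lemma wval_cat w1 w2 : wval (w1 ++ w2) = wval w1 * wval w2.
Proof. by elim: w1 => [|l w1 IH] /=; rewrite ?mul1g ?IH ?mulgA. Qed.

Lemma wexp_cat w1 w2 : wexp (w1 ++ w2) = (wexp w1 + wexp w2)%R.
Proof. by rewrite /wexp big_cat. Qed.

Lemma wexp_cons l w : wexp (l :: w) = (lexp l + wexp w)%R.
Proof. by rewrite /wexp big_cons. Qed.

Lemma wexp_nil : wexp [::] = 0%R.
Proof. by rewrite /wexp big_nil. Qed.

Lemma winv_cons l w : winv (l :: w) = winv w ++ [:: (l.1, ~~ l.2)].
Proof. by rewrite /winv /= rev_cons cats1. Qed.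

Lemma wval_inv w : wval (winv w) = (wval w)^-1.
Proof.
elim: w => [|[i b] w IHw]; first by rewrite /= invg1.
rewrite winv_cons wval_cat IHw /= mulg1 invgM /lval /=.
by case: b; rewrite ?invgK.
Qed.

Lemma wexp_inv w : wexp (winv w) = (- wexp w)%R.
Proof.
elim: w => [|[i b] w IHw]; first by rewrite /winv /= wexp_nil.
rewrite winv_cons wexp_cat IHw !wexp_cons wexp_nil /lexp /=.
by case: b => /=; lia.
Qed.

Lemma wperm_cat w1 w2 : wperm (w1 ++ w2) = wperm w1 * wperm w2.
Proof. by elim: w1 => [|l w1 IH] /=; rewrite ?mul1g ?IH ?mulgA. Qed.

Lemma wsec_cat w1 w2 x : wsec (w1 ++ w2) x = wsec w1 x ++ wsec w2 (wperm w1 x).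
Proof.
elim: w1 x => [|l w1 IH] x /=; first by rewrite perm1.
by rewrite IH catA permM.
Qed.

Lemma lval_cons l x v : lval l (x :: v) = lperm l x :: wval (lsec l x) v.
Proof.
have genE i y u : gen i (y :: u) =
    tperm i (ordS i) y ::
    (if (y == i) || (y == ordS i) then gen y u else u).
  by rewrite /=; case: eqVneq => [->//|_] /=; case: eqVneq => [->|_].
case: l => i []; rewrite /lval /lperm /lsec.
  by rewrite genE; case: ifP; rewrite //= mulg1.
rewrite [fst _]/= [snd _]/=.
apply: (tree_aut_inj (g := gen i)); rewrite tree_autKV genE tpermK.
set act := (x == i) || _; set y := tperm _ _ x.
have -> : (y == i) || (y == ordS i) = act.
  rewrite /act /y.
  by case: tpermP => [->|->|/eqP/negPf-> /eqP/negPf->] //; rewrite !eqxx ?orbT.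
by case: act => //=; rewrite -[gen_fun y _]/(gen y _) tree_autKV.
Qed.

Lemma wval_consE w x v : wval w (x :: v) = wperm w x :: wval (wsec w x) v.
Proof.
elim: w x v => [|l w IHw] x v; first by rewrite perm1.
by rewrite [wval _]/= tree_autM lval_cons IHw /= wval_cat permM.
Qed.

Lemma wval1_perm w : wval w = 1 -> wperm w = 1.
Proof.
move=> w1; apply/permP => x; have := wval_consE w x [::].
by rewrite w1 perm1 => -[].
Qed.

Lemma wval1_sec w x : wval w = 1 -> wval (wsec w x) = 1.
Proof.
move=> w1; apply: tree_autE => v; have := wval_consE w x v.
by rewrite w1 => -[].
Qed.

Lemma size_wsec w x : size (wsec w x) <= size w.
Proof.
elim: w x => //= l w IHw x; rewrite size_cat -add1n leq_add //.
by rewrite /lsec; case: ifP.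
Qed.

(** Every letter of the word moves the current position of x, so that taking
    the section at x does not shorten the word. *)
Definition full w x := size (wsec w x) == size w.

Lemma full_cons l w x : full (l :: w) x =
  ((x == l.1) || (x == ordS l.1)) && full w (lperm l x).
Proof.
rewrite /full /= size_cat; have := size_wsec w (lperm l x).
by rewrite /lsec; case: ifP => //= _ h; lia.
Qed.

(** Passing to sections keeps the sign of the letters that contribute. *)
Lemma wexp_full w x : full w x -> wexp (wsec w x) = wexp w.
Proof.
elim: w x => // l w IHw x; rewrite full_cons => /andP[act /IHw IH].
by rewrite /= wexp_cat IH /lsec act !wexp_cons wexp_nil addr0.
Qed.

End Words.

Section WordsCycle.

Variable d : nat.
Hypothesis d_ge3 : 3 <= d.

Local Notation letter := ('I_d * bool)%type.
Local Notation gword := (seq letter).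
Implicit Types (l : letter) (w : gword) (x y : 'I_d).

Lemma sum_act l (F : 'I_d -> int) :
  (forall x, F x = if (x == l.1) || (x == ordS l.1) then lexp l else 0%R) ->
  (\sum_x F x = 2 * lexp l)%R.
Proof.
move=> FE; rewrite (bigD1 l.1) // (bigD1 (ordS l.1)) /=; last first.
  by rewrite ordS_neq.
rewrite !FE !eqxx orbT /= big1 => [|x /andP[/negPf x1 /negPf x2]]; first by lia.
by rewrite FE x1 x2.
Qed.

(** Each letter of the word moves exactly two positions, and contributes a
    generator of the same sign to the sections at both. *)
Lemma sum_wexp_wsec w : (\sum_x wexp (wsec w x) = 2 * wexp w)%R.
Proof.
elim: w => [|l w IHw].
  by rewrite wexp_nil big1 // => x _; apply: wexp_nil.
under eq_bigr do rewrite /= wexp_cat.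
rewrite big_split /= wexp_cons mulrDr -IHw; congr (_ + _)%R.
  apply: sum_act => x; rewrite /lsec.
  by case: ifP; rewrite ?wexp_cons wexp_nil ?addr0.
by rewrite [RHS](reindex_inj (@perm_inj _ (lperm l))).
Qed.

Lemma odd_wperm w : odd_perm (wperm w) = odd `|wexp w|.
Proof.
elim: w => [|l w IHw]; first by rewrite /= odd_perm1 wexp_nil.
rewrite /= odd_permM IHw /lperm odd_tperm eq_sym ordS_neq // wexp_cons /lexp.
by case: l.2 => /=; lia.
Qed.

(** The word w fixes i, so it has even length. Its section at i visits i and
    ordS i in turn; a letter of w met at i has index i in the section if it is
    positive and ordS i if it is negative, and conversely at ordS i. If the
    section has a single index too, the signs alternate. *)
Lemma single_index_section i j w :
  all (fun l => l.1 == i) w -> wperm w i = i ->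
  all (fun l => l.1 == j) (wsec w i) -> wexp w = 0%R.
Proof.
have [n] := ubnP (size w); elim: n w => // n IHn [|l1 [|l2 w]] //=.
- by rewrite wexp_nil.
- move=> _ /andP[/eqP l1i _].
  by rewrite mulg1 /lperm l1i tpermL => /eqP; rewrite ordS_neq.
case: l1 l2 => [_ b1] [_ b2] lt_wn /= /and3P[/eqP-> /eqP-> wi].
rewrite !permM /lperm /lsec /= !eqxx tpermL tpermR !eqxx orbT /= => wii.
move=> /and3P[/eqP e1 /eqP e2 wj].
rewrite !wexp_cons (IHn w) //; last by lia.
have := ordS_neq d_ge3 i; move: e1 e2; rewrite /lexp /=.
by case: b1 b2 => [] [] //= -> ->; rewrite eqxx.
Qed.

(** With d >= 3 the pair {i, ordS i} determines i, so only gen i and its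
    inverse move both elements of the pair, and they preserve it. *)
Lemma full_pair_single_index i w :
  full w i -> full w (ordS i) -> all (fun l => l.1 == i) w.
Proof.
elim: w => // l w IHw; rewrite !full_cons => /andP[ai fi] /andP[aSi fSi] /=.
have li : l.1 = i.
  case/orP: ai => /eqP // il; case/orP: aSi => /eqP.
    by move=> Sil; have := ordSS_neq d_ge3 l.1; rewrite -il Sil eqxx.
  by move=> /ordS_inj.
move: fi fSi; rewrite /lperm li tpermL tpermR eqxx => fSi fi.
exact: IHw.
Qed.

(** Only the positions where w has a section of full length contribute to the
    sum of the exponent sums of the sections, which is twice that of w, and
    each contributes the exponent sum of w. So there are exactly two of
    them. *)
Lemma minimal_relator_single_index w :
  (forall w', size w' < size w -> wval w' = 1 -> wexp w' = 0%R) ->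
  wval w = 1 -> wexp w != 0%R ->
  exists i, full w i /\ all (fun l => l.1 == i) w.
Proof.
move=> IH w1 w0; pose F := [set x | full w x].
(* Positions outside F have shorter sections, trivial in the group. *)
have wF : (wexp w *+ #|F| = 2 * wexp w)%R.
  rewrite -sum_wexp_wsec -sumr_const [RHS](bigID (mem F)) /=.
  rewrite [X in (_ + X)%R]big1 ?addr0 => [|x]; last first.
    rewrite inE /full => xF; apply: IH; last exact: wval1_sec.
    by rewrite ltn_neqAle xF size_wsec.
  by apply: eq_bigr => x; rewrite inE => /wexp_full.
have /cards2P[x [y [xy FE]]] : #|F| == 2.
  by move: wF; rewrite -mulr_natr natz; nia.
have [fx fy] : full w x /\ full w y.
  by split; [have := set21 x y|have := set22 x y]; rewrite -FE inE.
case: w w0 {w1 IH wF F FE} fx fy => [|l w]; first by rewrite wexp_nil.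
move=> _ fx fy; have := fx; have := fy.
rewrite !full_cons => /andP[ay _] /andP[ax _].
suff [fi fSi] : full (l :: w) l.1 /\ full (l :: w) (ordS l.1).
  by exists l.1; split=> //; apply: full_pair_single_index.
case/orP: ax fx xy => /eqP->; case/orP: ay fy => /eqP-> // fx fy.
all: by rewrite eqxx.
Qed.

(** In a shortest counterexample w, the section at i given by
    [minimal_relator_single_index] is another shortest counterexample, hence it
    has a single index as well, against [single_index_section]. *)
Lemma relator_wexp0 w : wval w = 1 -> wexp w = 0%R.
Proof.
have [n] := ubnP (size w); elim: n w => // n IHn w lt_wn w1.
apply/eqP/negPn/negP => w0.
have IH w' : size w' < size w -> wval w' = 1 -> wexp w' = 0%R.
  by move=> lt_w'; apply: IHn; lia.
have [i [fi wi]] := minimal_relator_single_index IH w1 w0.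
have szE : size (wsec w i) = size w by apply/eqP.
have [|||j [_ wj]] := @minimal_relator_single_index (wsec w i).
- by rewrite szE.
- exact: wval1_sec.
- by rewrite wexp_full.
by case/eqP: w0; apply: single_index_section wi _ wj; rewrite wval1_perm ?perm1.
Qed.

End WordsCycle.

(** * Sections, and the exponent sum on the group *)

Section Sections.

Variable d : nat.
Implicit Types (g h : tree_aut d) (u v : word d) (x y : 'I_d).

Definition sec_fun g u v : word d := drop (size u) (g (u ++ v)).

Lemma sec_funE g u v : g (u ++ v) = g u ++ sec_fun g u v.
Proof.
have : prefix (g u) (g (u ++ v)) by rewrite prefix_tree_aut prefix_prefix.
by case/prefixP => s gE; rewrite /sec_fun gE drop_size_cat ?size_tree_aut.
Qed.

Lemma cat_injr u : injective (cat u).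
Proof. by move=> v1 v2 /eqP; rewrite eqseq_cat // eqxx => /eqP. Qed.

Lemma adjacent_cat u v1 v2 : adjacent (u ++ v1) (u ++ v2) <-> adjacent v1 v2.
Proof.
split=> -[x] [] => [|||->]; last by exists x; right; rewrite rcons_cat.
- by rewrite rcons_cat => /cat_injr->; exists x; left.
- by rewrite rcons_cat => /cat_injr->; exists x; right.
- by move=> ->; exists x; left; rewrite rcons_cat.
Qed.

Lemma sec_subproof g u : `[< is_tree_aut (sec_fun g u) >].
Proof.
apply/asboolP; split.
- exists (sec_fun g^-1 (g u)) => v; rewrite {1}/sec_fun.
    by rewrite -sec_funE tree_autK size_tree_aut drop_size_cat.
  have gV w : g^-1 (g u ++ w) = u ++ sec_fun g^-1 (g u) w.
    by rewrite sec_funE tree_autK.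
  by rewrite -gV tree_autKV drop_size_cat ?size_tree_aut.
- by rewrite /sec_fun cats0 drop_oversize // size_tree_aut.
- have [_ _ ag] := tree_autP g; move=> v1 v2.
  by rewrite -(adjacent_cat (g u)) -!sec_funE ag adjacent_cat.
Qed.

Definition sec g u : tree_aut d := TreeAut (sec_subproof g u).

Lemma secE g u v : g (u ++ v) = g u ++ sec g u v.
Proof. exact: sec_funE. Qed.

Lemma sec_unique g u h : is_section g u h -> sec g u = h.
Proof.
move=> gu; apply: tree_autE => v; have := gu v; rewrite secE => /eqP.
by rewrite eqseq_cat // eqxx => /eqP.
Qed.

Lemma sec1 u : sec 1 u = 1.
Proof. exact: sec_unique. Qed.

Lemma secM g h u : sec (g * h) u = sec g u * sec h (g u).
Proof. by apply: sec_unique => v; rewrite !tree_autM !secE. Qed.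

Lemma secV g u : sec g^-1 (g u) = (sec g u)^-1.
Proof. by symmetry; apply: mulg1_eq; rewrite -secM mulgV sec1. Qed.

Lemma sec_cat g u v : sec g (u ++ v) = sec (sec g u) v.
Proof. by apply: sec_unique => w; rewrite -catA !secE catA. Qed.

Lemma sec_nil g : sec g [::] = g.
Proof. by apply: sec_unique => v; rewrite tree_aut_nil. Qed.

End Sections.

Section Exponent.

Variable d : nat.
Implicit Types (g h : tree_aut d) (u v : word d) (x y : 'I_d).

Lemma GdP g : reflect (exists w, g = wval w) (g \in @Gd d).
Proof.
apply: (iffP idP) => [/generatedP gS | [w ->]]; last first.
  elim: w => [|[i b] w IHw]; first exact: gpred1.
  apply: gpredM IHw; rewrite /lval /=.
  by case: b; rewrite ?gpredV; apply: mem_generated; exists i.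
pose S : {pred tree_aut d} := fun g => `[< exists w, g = wval w >].
have S_closed : group_closed S.
  split=> [|_ _ /asboolP[w ->] /asboolP[w' ->]]; apply/asboolP.
    by exists [::].
  by exists (w ++ winv w'); rewrite wval_cat wval_inv.
pose S' := HB.pack_for (groupClosed (tree_aut d)) S
  (isGroupClosed.Build (tree_aut d) S S_closed).
have /asboolP // : g \in S'.
apply: gS => _ [i ->]; apply/asboolP.
by exists [:: (i, true)]; rewrite /= mulg1.
Qed.

Lemma sec_Gd g u : g \in @Gd d -> sec g u \in @Gd d.
Proof.
elim: u g => [|x u IHu] g; first by rewrite sec_nil.
move=> /GdP[w ->]; rewrite -cat1s sec_cat; apply: IHu; apply/GdP.
exists (wsec w x); apply: sec_unique => v.
by rewrite !wval_consE /= tree_aut_nil.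
Qed.

(** The choice of the word for g is immaterial, by [relator_wexp0]. *)
Definition expo g : int :=
  if pselect (exists w, g = wval w) is left ex_w then wexp (sval (cid ex_w))
  else 0%R.

Hypothesis d_ge3 : 3 <= d.

Lemma expo_wval w : expo (wval w) = wexp w.
Proof.
rewrite /expo; case: pselect => [ex_w | []]; last by exists w.
case: cid => w' /= ww'; apply/eqP; rewrite -subr_eq0; apply/eqP.
rewrite -wexp_inv -wexp_cat; apply: relator_wexp0 => //.
by rewrite wval_cat wval_inv ww' mulgV.
Qed.

Lemma expo1 : expo 1 = 0%R.
Proof. by rewrite -[1]/(wval [::]) expo_wval wexp_nil. Qed.

Lemma expoM g h : g \in @Gd d -> h \in @Gd d ->
  expo (g * h) = (expo g + expo h)%R.
Proof.
move=> /GdP[w ->] /GdP[w' ->].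
by rewrite -wval_cat !expo_wval wexp_cat.
Qed.

Lemma expoV g : g \in @Gd d -> expo g^-1 = (- expo g)%R.
Proof. by move=> /GdP[w ->]; rewrite -wval_inv !expo_wval wexp_inv. Qed.

Lemma sec_wval w x : sec (wval w) [:: x] = wval (wsec w x).
Proof. by apply: sec_unique => v; rewrite !wval_consE /= tree_aut_nil. Qed.

Lemma sum_expo_sec g u : g \in @Gd d ->
  (\sum_x expo (sec g (rcons u x)) = 2 * expo (sec g u))%R.
Proof.
move=> /sec_Gd-/(_ u)/GdP[w gw]; rewrite gw expo_wval -sum_wexp_wsec //.
by apply: eq_bigr => x _; rewrite -cats1 sec_cat gw sec_wval expo_wval.
Qed.

(** A generator acts on the first level by a transposition, so the permutation
    has the parity of the exponent sum. *)
Lemma expo_even g : g \in @Gd d -> (forall x, g [:: x] = [:: x]) ->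
  (2 %| expo g)%Z.
Proof.
move=> /GdP[w ->] w_fix; rewrite expo_wval; have := odd_wperm d_ge3 w.
have -> : wperm w = 1.
  apply/permP => x; have := w_fix x.
  by rewrite wval_consE perm1 => -[].
by rewrite odd_perm1; lia.
Qed.

End Exponent.

(** * Elements supported on one subtree of the first level *)

Section Realizable.

Variable d : nat.
Hypothesis d_ge3 : 3 <= d.
Implicit Types (g h s t : tree_aut d) (u v : word d) (x y z i : 'I_d).
Implicit Types f : 'I_d -> tree_aut d.

Definition realizable f : Prop :=
  exists2 g, g \in @Gd d & forall x v, g (x :: v) = x :: f x v.

Lemma realizable_ext f f' : f =1 f' -> realizable f -> realizable f'.
Proof. by move=> ff' [g Gg gE]; exists g => // x v; rewrite gE ff'. Qed.

Lemma realizable1 : realizable (fun=> 1).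
Proof. by exists 1; rewrite ?gpred1. Qed.

Lemma realizableM f f' :
  realizable f -> realizable f' -> realizable (fun x => f x * f' x).
Proof.
move=> [g Gg gE] [g' Gg' gE']; exists (g * g'); first exact: gpredM.
by move=> x v; rewrite !tree_autM gE gE'.
Qed.

Lemma realizableV f : realizable f -> realizable (fun x => (f x)^-1).
Proof.
move=> [g Gg gE]; exists g^-1; first by rewrite gpredV.
by move=> x v; apply: (tree_aut_inj (g := g)); rewrite tree_autKV gE tree_autKV.
Qed.

Definition carries s x y : Prop :=
  exists2 g, g \in @Gd d & forall v, g (x :: v) = y :: s v.

Lemma carriesM s t x y z :
  carries s x y -> carries t y z -> carries (s * t) x z.
Proof.
move=> [g Gg gE] [h Gh hE]; exists (g * h); first exact: gpredM.
by move=> v; rewrite !tree_autM gE hE.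
Qed.

Lemma carriesV s x y : carries s x y -> carries s^-1 y x.
Proof.
move=> [g Gg gE]; exists g^-1; first by rewrite gpredV.
by move=> v; apply: (tree_aut_inj (g := g)); rewrite tree_autKV gE tree_autKV.
Qed.

Lemma gen_Gd i : gen i \in @Gd d.
Proof. by apply: mem_generated; exists i. Qed.

Lemma carries_gen i : carries (gen i) i (ordS i).
Proof. by exists (gen i); rewrite ?gen_Gd // => v /=; rewrite tpermL eqxx. Qed.

Lemma carries_gen_back i : carries (gen (ordS i)) (ordS i) i.
Proof.
exists (gen i); rewrite ?gen_Gd // => v /=.
by rewrite tpermR ordS_neq // eqxx.
Qed.

Hypothesis d_odd : odd d.

(** The generator gen i leaves ordS i for i with section gen (ordS i), while
    gen (ordS i) leaves ordS i for ordS (ordS i) with the same section. So i is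
    sent to ordS (ordS i) with trivial section, and such steps reach every
    letter since d is odd. *)
Lemma carries_one x y : carries 1 x y.
Proof.
move: y; apply: (@ordSS_ind _ _ x d_odd) => [|y].
  by exists 1; rewrite ?gpred1.
rewrite -{2}[1]mul1g => /carriesM; apply.
rewrite -[1](mulVg (gen (ordS y))).
exact: carriesM (carriesV (carries_gen_back y)) (carries_gen (ordS y)).
Qed.

Lemma carries_all s x y : s \in @Gd d -> carries s x y.
Proof.
have Cgen i x' y' : carries (gen i) x' y'.
  rewrite -[gen i]mulg1 -[gen i]mul1g.
  apply: carriesM (carries_one _ y'); apply: carriesM (carries_gen i).
  exact: carries_one.
move=> /GdP[w ->]; elim: w x => [|[i b] w IHw] x; first exact: carries_one.
apply: carriesM (IHw x); rewrite /lval /=; case: b => //.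
exact: carriesV.
Qed.

Definition slice x s : 'I_d -> tree_aut d := fun y => if y == x then s else 1.

Lemma slice1 x : slice x 1 =1 fun=> 1.
Proof. by move=> y; rewrite /slice if_same. Qed.

Lemma sliceM x s t y : slice x (s * t) y = slice x s y * slice x t y.
Proof. by rewrite /slice; case: ifP; rewrite ?mulg1. Qed.

Lemma realizable_sliceM x s t :
  realizable (slice x s) -> realizable (slice x t) ->
  realizable (slice x (s * t)).
Proof.
move=> Rs Rt; apply: realizable_ext (realizableM Rs Rt) => y.
by rewrite sliceM.
Qed.

(** Conjugation by an element carrying x to y with section t, which exists by
    [carries_all]. So the subgroup of the s that can be placed alone on the
    subtree at x is normal, and it is the same for all x. *)
Lemma realizable_sliceJ x y s t : t \in @Gd d ->
  realizable (slice x s) -> realizable (slice y (s ^ t)).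
Proof.
move=> Gt [p Gp pE]; have [g Gg gE] := carries_all x y Gt.
exists (p ^ g); first exact: gpredJ.
move=> z v; rewrite conjgE !tree_autM /slice.
case: eqVneq => [-> | zy].
  have -> : g^-1 (y :: v) = x :: t^-1 v.
    by apply: (tree_aut_inj (g := g)); rewrite tree_autKV gE tree_autKV.
  by rewrite pE /slice eqxx gE.
case gV: (g^-1 (z :: v)) => [|z' v'].
  by have := congr1 size gV; rewrite size_tree_aut.
rewrite pE /slice; case: eqVneq => [z'x | _]; last first.
  by rewrite tree_aut1E -gV tree_autKV.
have := congr1 g gV; rewrite tree_autKV z'x gE => -[/eqP].
by rewrite (negPf zy).
Qed.

(** With a = gen i, b = gen (ordS i) and c = gen (ordS (ordS i)), the elements
    a b a and b a b act in the same way on the first level, and their sections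
    differ only at the letter ordS i, where they are b a and b c. *)
Lemma realizable_braid i :
  realizable (slice (ordS i)
    (gen (ordS i) * gen i * (gen (ordS (ordS i)))^-1 * (gen (ordS i))^-1)).
Proof.
set a := i; set b := ordS i; set c := ordS b.
pose w := [:: (a, true); (b, true); (a, true);
              (b, false); (a, false); (b, false)].
exists (wval w); first by apply/GdP; exists w.
have ba : (b == a) = false by exact: ordS_neq.
have cb : (c == b) = false by exact: ordS_neq.
have ca : (c == a) = false by exact: ordSS_neq.
have [ab bc ac] : [/\ (a == b) = false, (b == c) = false & (a == c) = false].
  by rewrite !(eq_sym _ b) !(eq_sym _ c).
have bcD : tperm b c a = a by rewrite tpermD ?ba ?ca.
have abD : tperm a b c = c by rewrite tpermD ?ac ?bc.
have tE := (tpermL, tpermR, bcD, abD, eqxx, ab, ba, bc, cb, ac, ca).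
move=> x v; rewrite wval_consE; suff [-> ->] : wperm w x = x /\
    wval (wsec w x) = slice b (gen b * gen a * (gen c)^-1 * (gen b)^-1) x by [].
rewrite /w /= /lsec /lperm /slice /= -/b -/c !permM perm1.
case: (eqVneq x a) => [-> | xa].
  by rewrite !tE /= /lval /= mulg1 mulVKg mulgV.
case: (eqVneq x b) => [-> | xb].
  by rewrite !tE /= ?tE /lval /= mulg1 !mulgA.
case: (eqVneq x c) => [-> | xc].
  by rewrite !tE /= ?tE /lval /= mulg1 mulVKg mulgV.
have xab : tperm a b x = x by rewrite tpermD // eq_sym.
have xbc : tperm b c x = x by rewrite tpermD // eq_sym.
by rewrite !(xab, xbc) (negPf xa) (negPf xb) (negPf xc).
Qed.

Lemma realizable_gens x i j : realizable (slice x (gen i * (gen j)^-1)).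
Proof.
move: j; apply: (@ordSS_ind _ _ i d_odd) => [|j Rij].
  by apply: realizable_ext realizable1 => y; rewrite mulgV slice1.
have := realizable_sliceJ x (gen_Gd (ordS j)) (realizable_braid j).
rewrite conjgE mulgVK !mulgA mulVg mul1g => /(realizable_sliceM Rij).
by rewrite mulgA mulgVK.
Qed.

Definition relabel i (w : seq ('I_d * bool)) := [seq (i, l.2) | l <- w].

(** Modulo the normal subgroup of the elements that can be placed alone on a
    subtree all generators agree, by [realizable_gens]. *)
Lemma realizable_relabel x i w :
  realizable (slice x (wval w * (wval (relabel i w))^-1)).
Proof.
elim: w => [|[j b] w IHw].
  by apply: realizable_ext realizable1 => y; rewrite /= mulgV slice1.
have Gi : (lval (i, b))^-1 \in @Gd d.
  by rewrite gpredV; apply/GdP; exists [:: (i, b)]; rewrite /= mulg1.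
have := realizable_sliceJ x Gi IHw.
suff /realizable_sliceM RM :
    realizable (slice x (lval (j, b) * (lval (i, b))^-1)).
  by move=> /RM; rewrite conjgE invgK !mulgA mulgVK /= invgM !mulgA.
case: b {Gi}; rewrite /lval /=; first exact: realizable_gens.
have := realizable_sliceJ x (gen_Gd j) (realizable_gens x i j).
by rewrite conjgE mulgVK invgK.
Qed.

Lemma wval_relabel i w :
  wval (relabel i w) = gen i ^+ count snd w * gen i ^- count (negb \o snd) w.
Proof.
elim: w => [|[j b] w IHw]; first by rewrite /= invg1 mulg1.
rewrite /= IHw; case: b => /=; rewrite /lval /=.
  by rewrite add0n add1n expgS mulgA.
rewrite add0n add1n -!expVgn expgS !mulgA; congr (_ * _).
exact/commuteX/commute_sym/commuteV.
Qed.

Lemma wexp_count (w : seq ('I_d * bool)) :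
  wexp w = ((count snd w)%:Z - (count (negb \o snd) w)%:Z)%R.
Proof.
elim: w => [|[j b] w IHw]; first by rewrite wexp_nil.
by rewrite wexp_cons IHw /lexp; case: b => /=; lia.
Qed.

Lemma realizable_slice_expo0 x s :
  s \in @Gd d -> expo s = 0%R -> realizable (slice x s).
Proof.
move=> /GdP[w ->]; rewrite expo_wval // wexp_count => w0.
have := realizable_relabel x x w; rewrite wval_relabel.
have -> : count snd w = count (negb \o snd) w by lia.
by rewrite mulgV invg1 mulg1.
Qed.

Lemma realizable_expo0 f :
  (forall x, f x \in @Gd d) -> (forall x, expo (f x) = 0%R) -> realizable f.
Proof.
move=> Gf f0; suff Rs (s : seq 'I_d) :
    realizable (fun x => if x \in s then f x else 1).
  by apply: realizable_ext (Rs (enum 'I_d)) => x; rewrite mem_enum.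
elim: s => [|x s IHs]; first exact: realizable1.
have [xs | xs] := boolP (x \in s).
  apply: realizable_ext IHs => y.
  by rewrite inE; case: eqVneq => // ->; rewrite xs.
have Rx := realizable_slice_expo0 x (Gf x) (f0 x).
apply: realizable_ext (realizableM Rx IHs) => y.
rewrite inE /slice; case: eqVneq => [->|_]; first by rewrite (negPf xs) mulg1.
by rewrite mul1g.
Qed.

End Realizable.

(** * Exponent sums of the sections at the first level *)

Section Labels.

Variable d : nat.
Hypothesis d_ge3 : 3 <= d.
Implicit Types (x y z i : 'I_d) (s t : 'S_d) (a b e : 'I_d -> int) (m n : int).

(** The pairs (s, a) form the image of the group in the wreath product of the
    integers by the symmetric group. *)
Definition labelled s a : Prop :=
  exists2 w, wperm w = s & forall x, wexp (wsec w x) = a x.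

Lemma labelled_ext s a b : a =1 b -> labelled s a -> labelled s b.
Proof. by move=> ab [w ws wa]; exists w => // x; rewrite wa. Qed.

Lemma labelled1 : labelled 1 (fun=> 0%R).
Proof. by exists [::] => // x; rewrite wexp_nil. Qed.

Lemma labelledM s t a b :
  labelled s a -> labelled t b -> labelled (s * t) (fun x => a x + b (s x))%R.
Proof.
move=> [w ws wa] [w' ws' wa']; exists (w ++ w').
  by rewrite wperm_cat ws ws'.
by move=> x; rewrite wsec_cat wexp_cat wa wa' ws.
Qed.

Lemma labelledV s a : labelled s a -> labelled s^-1 (fun x => - a (s^-1%g x))%R.
Proof.
have letterV (l : 'I_d * bool) :
    labelled (lperm l)^-1 (fun x => - wexp (lsec l ((lperm l)^-1%g x)))%R.
  rewrite /lperm tpermV; exists [:: (l.1, ~~ l.2)] => [|x].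
    by rewrite /= mulg1.
  rewrite /= cats0 /lsec /lperm /=; set y := tperm _ _ x.
  have -> : (y == l.1) || (y == ordS l.1) = (x == l.1) || (x == ordS l.1).
    rewrite /y.
    case: tpermP => [->|->|/eqP/negPf-> /eqP/negPf->] //.
      by rewrite !eqxx ?orbT.
    by rewrite !eqxx ?orbT.
  case: ifP; rewrite ?wexp_cons wexp_nil ?addr0 ?oppr0 //.
  by rewrite /lexp /=; case: l.2.
move=> [w]; elim: w s a => [|l w IHw] s a /= <- wa.
  by rewrite invg1; apply: labelled_ext labelled1 => x; rewrite -wa wexp_nil.
have IH := IHw (wperm w) (fun x => wexp (wsec w x)) erefl (fun x => erefl).
rewrite invgM; apply: labelled_ext (labelledM IH (letterV l)) => x.
by rewrite -wa wexp_cat !permM permKV opprD addrC.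
Qed.

Lemma labelled_gen i : labelled (tperm i (ordS i))
  (fun x => (x == i)%:R + (x == ordS i)%:R)%R.
Proof.
exists [:: (i, true)] => [|x]; first by rewrite /= mulg1.
rewrite /= cats0 /lsec /=; have iS : (i == ordS i) = false.
  by rewrite eq_sym ordS_neq.
have [->|_] := eqVneq x i; first by rewrite iS wexp_cons wexp_nil.
by have [_|_] := eqVneq x (ordS i); rewrite ?wexp_cons wexp_nil.
Qed.

Lemma labelledJ s t a b : labelled s a -> labelled t b ->
  labelled (s ^ t)
    (fun x => - b (t^-1%g x) + a (t^-1%g x) + b (s (t^-1%g x)))%R.
Proof.
move=> sa tb; rewrite conjgE.
apply: labelled_ext (labelledM (labelledV tb) (labelledM sa tb)) => x.
by rewrite addrA.
Qed.

(** Conjugating a transposition (x y) by the generator that exchanges y and its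
    successor c yields the transposition (x c); the label at x gains the 1 of
    the step from y to c, and the other label loses the 1 of the step back. *)
Lemma labelled_tperm_iter (n : nat) x : n.+1 < d ->
  let y := iter n.+1 (@ordS d) x in
  labelled (tperm x y)
    (fun z => (z == x)%:R * n.+1%:R + (z == y)%:R * (1 - n%:R))%R.
Proof.
elim: n => [|n IHn] lt_nd /=.
  apply: labelled_ext (labelled_gen x) => z; rewrite !mulr1n subr0 !mulr1.
  by [].
set y := ordS (iter n _ x); set c := ordS y.
have IH := IHn (ltnW lt_nd).
have inj (m m' : nat) : m < d -> m' < d -> m <> m' ->
    (iter m (@ordS d) x == iter m' (@ordS d) x) = false.
  by move=> md md' mm'; apply/eqP => /(@iter_ordS_inj d) E; apply/mm'/E.
have yx : (y == x) = false by apply: (inj n.+1 0); lia.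
have cx : (c == x) = false by apply: (inj n.+2 0); lia.
have cy : (c == y) = false by apply: (inj n.+2 n.+1); lia.
have := labelledJ IH (labelled_gen y).
rewrite -/y -/c; set t := tperm y c.
have tx : t x = x by rewrite tpermD // ?yx ?cx.
have -> : tperm x y ^ t = tperm x c.
  by rewrite -[tperm x y ^ t]/(_ ^ _) tpermJ tx tpermL.
apply: labelled_ext => z; rewrite tpermV -/t.
have [xy xc yc] : [/\ (x == y) = false, (x == c) = false & (y == c) = false].
  by rewrite !(eq_sym x) (eq_sym y c).
have dE := (eqxx, yx, cx, cy, xy, xc, yc).
case: (eqVneq z x) => [-> | zx].
  by rewrite tx tpermL !dE; lia.
case: (eqVneq z y) => [-> | zy].
  by rewrite tpermL tpermD ?dE //; lia.
case: (eqVneq z c) => [-> | zc].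
  by rewrite tpermR tpermR !dE; lia.
have tz : t z = z by rewrite tpermD // eq_sym.
have xyz : tperm x y z = z by rewrite tpermD // eq_sym.
by rewrite tz xyz (negPf zx) (negPf zy) (negPf zc); lia.
Qed.

Lemma labelled_tperm x y : exists a, labelled (tperm x y) a.
Proof.
move: y; apply: (ordS_ind (x := x)) => [|y [a xy]].
  by exists (fun=> 0%R); rewrite tperm1; apply: labelled1.
have [-> | ySx] := eqVneq (ordS y) x.
  by exists (fun=> 0%R); rewrite tperm1; apply: labelled1.
have [xy_eq | yx] := eqVneq y x.
  by rewrite xy_eq; eexists; apply: labelled_gen.
eexists; have := labelledJ xy (labelled_gen y).
by rewrite tpermJ tpermL tpermD //; apply.
Qed.

Lemma labelled_perm s : exists a, labelled s a.
Proof.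
have [ts -> _] := prod_tpermP s; elim: ts => [|[x y] ts [a IH]].
  by exists (fun=> 0%R); rewrite big_nil; apply: labelled1.
have [b xy] := labelled_tperm x y.
by rewrite big_cons; eexists; apply: labelledM xy IH.
Qed.

Definition pure a : Prop := labelled 1 a.

Lemma pure_ext a b : a =1 b -> pure a -> pure b.
Proof. exact: labelled_ext. Qed.

Lemma pure0 : pure (fun=> 0%R). Proof. exact: labelled1. Qed.

Lemma pureD a b : pure a -> pure b -> pure (fun x => a x + b x)%R.
Proof.
move=> pa pb; have := labelledM pa pb; rewrite mulg1.
by apply: labelled_ext => x; rewrite perm1.
Qed.

Lemma pureN a : pure a -> pure (fun x => - a x)%R.
Proof.
move=> pa; have := labelledV pa; rewrite invg1.
by apply: labelled_ext => x; rewrite perm1.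
Qed.

Lemma pureZ m a : pure a -> pure (fun x => m * a x)%R.
Proof.
have pureMn k : pure a -> pure (fun x => k%:R * a x)%R.
  move=> pa; elim: k => [|k IHk].
    by apply: pure_ext pure0 => x; rewrite mul0r.
  by apply: pure_ext (pureD pa IHk) => x; rewrite -add1n natrD; ring.
move=> pa; case: m => k.
  by apply: pure_ext (pureMn k pa) => x; rewrite natz.
by apply: pure_ext (pureN (pureMn k.+1 pa)) => x; rewrite NegzE natz mulNr.
Qed.

Lemma pure_sum (I : Type) (r : seq I) (F : I -> 'I_d -> int) :
  (forall j, pure (F j)) -> pure (fun x => \sum_(j <- r) F j x)%R.
Proof.
move=> pF; elim: r => [|j r IHr].
  by apply: pure_ext pure0 => x; rewrite big_nil.
by apply: pure_ext (pureD (pF j) IHr) => x; rewrite big_cons.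
Qed.

(** Conjugation by an element of the group permutes the exponent sums by its
    action on the first level: its own sections cancel in an abelian group. *)
Lemma pure_perm s a : pure a -> pure (fun x => a (s x)).
Proof.
move=> pa; have [b sb] := labelled_perm s^-1.
have := labelledJ pa sb; rewrite conj1g.
by apply: labelled_ext => x; rewrite perm1 invgK; lia.
Qed.

Definition pair_label m n y z : 'I_d -> int :=
  fun x => ((x == y)%:R * m + (x == z)%:R * n)%R.

Lemma pure_pair m n i j y z : i != j -> y != z ->
  pure (pair_label m n i j) -> pure (pair_label m n y z).
Proof.
move=> ij yz /(pure_perm (tperm i y * tperm (tperm i y j) z)^-1).
apply: pure_ext => x; rewrite /pair_label; set s := _ * _.
have si : s i = y.
  rewrite /s permM tpermL tpermD //; last by rewrite eq_sym.
  by rewrite -(inj_eq (@perm_inj _ (tperm i y))) tpermK tpermR eq_sym.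
have sj : s j = z by rewrite /s permM tpermL.
by rewrite -[y]si -[z]sj -{3 4}(permKV s x) !(inj_eq (@perm_inj _ s)).
Qed.

Lemma ord_third (y z : 'I_d) : exists t : 'I_d, (t != y) && (t != z).
Proof.
apply/existsP; apply: contraT => /existsPn yz.
have : #|[set: 'I_d]| <= #|[set y; z]|.
  apply/subset_leq_card/subsetP => t _; have := yz t.
  by rewrite !inE negb_and !negbK.
by rewrite cardsT card_ord cards2; lia.
Qed.

Lemma neq_ordS i : i != ordS i.
Proof. by rewrite eq_sym ordS_neq. Qed.

(** These are the squares of the generators, up to [pure_pair]. *)
Lemma pure_double_sum y z : y != z -> pure (pair_label 2 2 y z).
Proof.
move=> yz; pose i : 'I_d := y; apply: (pure_pair (neq_ordS i) yz).
have := labelledM (labelled_gen i) (labelled_gen i); rewrite tperm2.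
apply: labelled_ext => x; rewrite /pair_label.
have := ordS_neq d_ge3 i.
case: tpermP => [->|->|/eqP/negPf-> /eqP/negPf->] // e.
  by rewrite !eqxx e eq_sym e.
by rewrite !eqxx e eq_sym e.
Qed.

Lemma pure_double_diff y z : y != z -> pure (pair_label 2 (-2) y z).
Proof.
move=> yz; have [t /andP[ty tz]] := ord_third y z.
have p1 := pure_double_sum (y := y) (z := t); have p2 := pure_double_sum tz.
rewrite eq_sym in ty; apply: pure_ext (pureD (p1 ty) (pureN p2)) => x.
by rewrite /pair_label; lia.
Qed.

Hypothesis d_odd : odd d.

(** Transporting the transposition of i and ordS i all around the cycle gives
    (i j) with j the predecessor of i, as does gen j, but with labels d - 1 and
    3 - d instead of 1 and 1. For odd d the quotient has odd labels, which the
    squares of the generators and their conjugates cannot produce. *)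
Lemma pure_odd_diff y z : y != z -> pure (pair_label (d%:R - 2) (2 - d%:R) y z).
Proof.
move=> yz; pose i : 'I_d := y; pose j := iter d.-1 (@ordS d) i.
have Sj : ordS j = i.
  apply: ord_inj; rewrite -[ordS j]/(iter d.-1.+1 (@ordS d) i) iter_ordS_val.
  by rewrite prednK ?modnDr ?modn_small //; lia.
have ij : i != j by rewrite -Sj eq_sym neq_ordS.
apply: (pure_pair ij yz).
have T := labelled_tperm_iter (n := d.-2) i; rewrite /= in T.
have e : d.-2.+1 = d.-1 by lia.
rewrite -[ordS _]/(iter d.-2.+1 _ _) e -/j in T.
have d1 : d.-1 < d by lia.
have {}T := T d1.
have := labelledM T (labelledV (labelled_gen j)).
rewrite Sj [tperm j i]tpermC mulgV tpermV; apply: labelled_ext => x.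
have -> : (d.-1%:R = d%:R - 1 :> int)%R by lia.
have -> : (d.-2%:R = d%:R - 2 :> int)%R by lia.
by rewrite /pair_label tpermK; ring.
Qed.

Lemma pure_diff y z : y != z -> pure (pair_label 1 (-1) y z).
Proof.
move=> yz; pose k : int := ((d./2)%:R - 1)%R.
have := pureD (pure_odd_diff yz) (pureN (pureZ k (pure_double_diff yz))).
apply: pure_ext => x; rewrite /pair_label /k.
have -> : (d%:R = 2 * (d./2)%:R + 1 :> int)%R by lia.
ring.
Qed.

Lemma pure_four y : pure (fun x => (x == y)%:R * 4)%R.
Proof.
have := pureD (pure_double_sum (neq_ordS y)) (pure_double_diff (neq_ordS y)).
by apply: pure_ext => x; rewrite /pair_label; lia.
Qed.

(** Moving all the entries to one letter x0 with [pure_diff] leaves a multiple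
    of 4 at x0. *)
Lemma pure_sum_mod4 a : (4 %| (\sum_x a x)%R)%Z -> pure a.
Proof.
move=> /dvdzP[q a4]; have x0 : 'I_d by exists 0; lia.
have pd y : pure (fun x => a y * ((x == y)%:R - (x == x0)%:R))%R.
  have [-> | yx] := eqVneq y x0.
    by apply: pure_ext pure0 => x; rewrite subrr mulr0.
  apply: pure_ext (pureZ (a y) (pure_diff yx)) => x.
  by rewrite /pair_label; ring.
have p_sum := pure_sum (index_enum 'I_d) pd.
apply: pure_ext (pureD p_sum (pureZ q (pure_four x0))) => x.
under eq_bigr do rewrite mulrBr; rewrite big_split /= sumrN -big_distrl /= a4.
rewrite (bigD1 x) //= eqxx big1 => [|y /negPf]. by rewrite mulr1 addr0; ring.
by rewrite eq_sym => ->; rewrite mulr0.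
Qed.

(** The condition is also necessary, by [sum_expo_sec] and [expo_even]. A word
    with the right exponent sums has sections that differ from the f x only by
    elements of exponent sum 0, which [realizable_expo0] provides. *)
Lemma realizable_sum_mod4 (f : 'I_d -> tree_aut d) :
  (forall x, f x \in @Gd d) -> (4 %| (\sum_x expo (f x))%R)%Z -> realizable f.
Proof.
move=> Gf /pure_sum_mod4[w w1 wf].
pose r x := f x * (wval (wsec w x))^-1.
have Gw x : wval (wsec w x) \in @Gd d by apply/GdP; exists (wsec w x).
have Rr : realizable r.
  apply: realizable_expo0 => // x; first by rewrite gpredF.
  by rewrite expoM ?gpredV // expoV // expo_wval // wf subrr.
have Rw : realizable (fun x => wval (wsec w x)).
  exists (wval w); first by apply/GdP; exists w.
  by move=> x v; rewrite wval_consE w1 perm1.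
by apply: realizable_ext (realizableM Rr Rw) => x; rewrite mulgVK.
Qed.

End Labels.

(** * Rigid stabilizers of the levels *)

Section LevelRist.

Variable d : nat.
Hypothesis d_ge3 : 3 <= d.
Hypothesis d_odd : odd d.

Local Notation G := (subg (@Gd d)).
Implicit Types (g h : G) (u v w : word d) (x y : 'I_d).

Definition sexpo g u : int := expo (sec (val g) u).

Lemma sec_valGd g u : sec (val g) u \in @Gd d.
Proof. exact/sec_Gd/valP. Qed.

Lemma sexpoM g h u : val g u = u -> sexpo (g * h) u = (sexpo g u + sexpo h u)%R.
Proof. by move=> gu; rewrite /sexpo secM gu expoM ?sec_valGd. Qed.

Lemma sexpoV g u : val g u = u -> sexpo g^-1 u = (- sexpo g u)%R.
Proof. by move=> gu; rewrite /sexpo -{1}gu secV expoV ?sec_valGd. Qed.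

Lemma sum_sexpo g u : (\sum_x sexpo g (rcons u x) = 2 * sexpo g u)%R.
Proof. by apply: sum_expo_sec => //; apply: valP. Qed.

Lemma level_stabP k g :
  reflect (forall u, size u = k -> val g u = u) (g \in level_stab k).
Proof. exact: asboolP. Qed.

Lemma level_stab_le k j g : j <= k -> g \in level_stab k -> g \in level_stab j.
Proof.
move=> /subnK<-; elim: (k - j) => // n IHn gk.
exact/IHn/level_stabS.
Qed.

Lemma sexpo_even k g u : g \in level_stab k -> size u < k -> (2 %| sexpo g u)%Z.
Proof.
move=> gk uk; apply: expo_even => //; first exact: sec_valGd.
move=> x; have /level_stabP gu := level_stab_le (ltnW uk) gk.
have /level_stabP gux := level_stab_le uk gk.
have := gux (u ++ [:: x]); rewrite secE gu // size_cat addn1.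
by move=> /(_ erefl)/cat_injr.
Qed.

Lemma sec_fixed g u : (forall v, val g (u ++ v) = u ++ v) -> sec (val g) u = 1.
Proof.
by move=> gu; apply: sec_unique => v; rewrite gu -{2}[u]cats0 gu cats0.
Qed.

(** On the way down to u all the other children have trivial sections, so the
    exponent sum is doubled at each step. *)
Lemma sexpo_rist g u v w : g \in rist u -> u = v ++ w ->
  sexpo g v = (2 ^+ size v * sexpo g [::])%R.
Proof.
move=> /asboolP gu; elim/last_ind: v w => [|v x IHv] w uE.
  by rewrite mul1r.
rewrite cat_rcons in uE; rewrite size_rcons exprS -mulrA -(IHv _ uE) -sum_sexpo.
rewrite (bigD1 x) //= big1 ?addr0 // => y yx.
rewrite /sexpo sec_fixed ?expo1 // => t.
apply: gu; rewrite uE cat_rcons -cat1s -[y :: t]cat1s.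
apply/prefixP => -[r]; rewrite -!catA => /cat_injr[xy].
by rewrite xy eqxx in yx.
Qed.

Lemma level_rist_dvd k g : g \in level_rist k.+1 ->
  forall u, size u = k.+1 -> (2 ^+ k.+2 %| sexpo g u)%Z.
Proof.
pose S : {pred G} := fun g => (g \in level_stab k.+1) &&
  `[< forall u, size u = k.+1 -> (2 ^+ k.+2 %| sexpo g u)%Z >].
have S_closed : group_closed S.
  split=> [|{}g h /andP[gk /asboolP ge] /andP[hk /asboolP he]]; apply/andP.
    by split; [exact: gpred1 | apply/asboolP => u _; rewrite /sexpo sec1 expo1].
  split; first exact: gpredF.
  apply/asboolP => u uk; have /level_stabP gu := gk; have /level_stabP hu := hk.
  by rewrite sexpoM ?gu // sexpoV ?hu // rpredD ?rpredN ?ge ?he.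
pose S' := HB.pack_for (groupClosed G) S (isGroupClosed.Build G S S_closed).
move=> /generatedP gS; have /andP[_ /asboolP//] : g \in S'.
apply: gS => h [u uk hu]; have hk : h \in level_stab k.+1.
  by apply: level_rist_stab; apply: mem_generated; exists u.
apply/andP; split=> //; apply/asboolP => v vk.
have [-> | vu] := eqVneq v u; last first.
  rewrite /sexpo sec_fixed ?expo1 // => t; move/asboolP: hu; apply.
  rewrite prefixE uk -vk take_size_cat //.
rewrite (sexpo_rist hu (esym (cats0 u))) uk [in X in (X %| _)%Z]exprSr.
by rewrite dvdz_mul // (sexpo_even hk).
Qed.

(** Going up from u to the root the exponent sum is halved at each step, and it
    must be divisible by 4 before each step for [realizable_sum_mod4] to apply:
    hence one factor of 2 more than the length of u. *)
Lemma rist_lift u s : s \in @Gd d -> (2 ^+ (size u).+1 %| expo s)%Z ->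
  exists h : G, [/\ h \in rist u, forall v, val h (u ++ v) = u ++ s v
    & (expo s = 2 ^+ size u * expo (val h))%R].
Proof.
elim: u s => [|x u IHu] s Gs ds.
  exists (Subg Gs); split=> //; last by rewrite mul1r.
  by apply/asboolP => w; rewrite prefix0s.
have [|h [hu hs he]] := IHu s Gs.
  by apply: dvdz_trans ds; rewrite /= [X in (_ %| X)%Z]exprS dvdz_mull.
have dh : (4 %| expo (val h))%Z.
  have e4 : (2 ^+ (size u).+2 = 2 ^+ size u * 4 :> int)%R.
    by rewrite !exprSr -mulrA.
  by move: ds; rewrite he /= e4 dvdz_mul2l // expf_neq0.
have [||g Gg gE] := @realizable_sum_mod4 d d_ge3 d_odd (slice x (val h)).
- move=> y; rewrite /slice; case: ifP => _; first exact: valP. exact: gpred1.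
- rewrite (bigD1 x) //= /slice eqxx big1 ?addr0 // => y /negPf->.
  exact: expo1.
have secg y : sec g [:: y] = slice x (val h) y.
  by apply: sec_unique => v; rewrite !gE tree_aut_nil.
exists (Subg Gg); split=> /=.
- apply/asboolP => -[|y w]; first by rewrite tree_aut_nil.
  rewrite /= gE /slice; have [-> | //] := eqVneq y x.
  by move=> uw; move/asboolP: hu => ->.
- by move=> v; rewrite gE /slice eqxx hs.
have := sum_expo_sec d_ge3 [::] Gg; rewrite sec_nil (bigD1 x) //= big1 ?addr0.
  by rewrite secg /slice eqxx he exprSr -mulrA => ->.
by move=> y /negPf yx; rewrite secg /slice yx expo1.
Qed.

(** The sections of g at the vertices of the level are removed one at a time,
    each by an element of a rigid stabilizer given by [rist_lift]. *)
Lemma level_rist_of_dvd k g : g \in level_stab k.+1 ->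
  (forall u, size u = k.+1 -> (2 ^+ k.+2 %| sexpo g u)%Z) ->
  g \in level_rist k.+1.
Proof.
move=> gk ge.
suff H (s : seq (word d)) : forall g, g \in level_stab k.+1 ->
    (forall u, size u = k.+1 -> (2 ^+ k.+2 %| sexpo g u)%Z) ->
    (forall u, size u = k.+1 -> u \notin s -> sec (val g) u = 1) ->
    g \in level_rist k.+1.
  apply: (H [seq tval t | t : k.+1.-tuple 'I_d] g gk ge) => u uk /negP[].
  by apply/codomP; exists (tcast uk (in_tuple u)); rewrite val_tcast.
elim: s => [|u s IHs] {gk ge}g gk ge gs.
  have /level_stabP gfix := gk.
  suff -> : g = 1 by rewrite gpred1.
  apply/val_inj/tree_autE => w; have [wk | kw] := leqP (size w) k.+1.
    by have /level_stabP -> := level_stab_le wk gk.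
  have tk : size (take k.+1 w) = k.+1 by rewrite size_take kw.
  by rewrite -[w](cat_take_drop k.+1) secE gfix // gs.
have [uk | uk] := eqVneq (size u) k.+1; last first.
  apply: IHs => // v vk vs; apply: gs => //; rewrite inE negb_or vs andbT.
  by apply: contraNneq uk => <-; rewrite vk.
have [|h [hu hs _]] := @rist_lift u (sec (val g) u) (sec_valGd g u).
  by rewrite uk; apply: ge.
have hr : h \in level_rist k.+1 by apply: mem_generated; exists u.
have hk := level_rist_stab hr.
have [/level_stabP gf /level_stabP hf] := (gk, hk).
have secgh v : size v = k.+1 ->
    sec (val (g / h)) v = sec (val g) v * (sec (val h) v)^-1.
  by move=> vk; rewrite [val _]/= secM gf // -{2}(hf v vk) secV.
rewrite -[g](mulgVK h) gpredM //; apply: IHs; first exact: gpredF.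
- move=> v vk; rewrite sexpoM ?gf // sexpoV ?hf // rpredD ?rpredN ?ge //.
  exact: level_rist_dvd hr v vk.
- move=> v vk vs; rewrite secgh //; have [-> | vu] := eqVneq v u.
    suff -> : sec (val h) u = sec (val g) u by rewrite mulgV.
    by apply: sec_unique => t; rewrite hs hf.
  rewrite gs ?inE ?negb_or ?vu // sec_fixed ?invg1 ?mulg1 // => t.
  move/asboolP: hu; apply; rewrite prefixE uk -vk take_size_cat //.
Qed.

Lemma level_ristP k g : reflect
  (g \in level_stab k.+1 /\
     forall u, size u = k.+1 -> (2 ^+ k.+2 %| sexpo g u)%Z)
  (g \in level_rist k.+1).
Proof.
apply: (iffP idP) => [gr | [gk ge]]; last exact: level_rist_of_dvd.
by split; [apply: level_rist_stab | apply: level_rist_dvd].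
Qed.

Lemma exists_expo (m : int) : exists2 s, s \in @Gd d & expo s = m.
Proof.
have i : 'I_d by exists 0; lia.
exists (wval (nseq `|m| (i, (0 <= m)%R))); first by apply/GdP; eexists.
rewrite expo_wval // /wexp big_nseq iter_addr_0 /lexp /= -mulr_natr.
by case: ifP; lia.
Qed.

(** Evenness is what [realizable_sum_mod4] needs at each vertex: the sum over
    the children is 2 N u, hence divisible by 4. *)
Lemma exists_exponents (N : word d -> int) k :
  (forall u, (2 %| N u)%Z) -> (forall u, \sum_x N (rcons u x) = 2 * N u)%R ->
  exists2 g, g \in level_stab k & forall u, size u <= k -> sexpo g u = N u.
Proof.
move=> N2 NS; suff [s Gs [s_fix sN]] : exists2 s, s \in @Gd d &
    (forall u, size u <= k -> s u = u) /\
    (forall u, size u <= k -> expo (sec s u) = N u).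
  exists (Subg Gs) => //; apply/level_stabP => u uk.
  by rewrite /= s_fix // uk.
elim: k N N2 NS => [|k IHk] N N2 NS.
  have [s Gs sN] := exists_expo (N [::]); exists s => //.
  by split=> [[|//] _|[|//] _]; rewrite ?tree_aut_nil ?sec_nil.
have /fin_all_exists2[f Gf fP] x : exists2 s, s \in @Gd d &
    (forall u, size u <= k -> s u = u) /\
    (forall u, size u <= k -> expo (sec s u) = N (x :: u)).
  by apply: (IHk (fun u => N (x :: u))) => [u|u]; rewrite ?N2 // -NS.
have sumf : (\sum_x expo (f x) = 2 * N [::])%R.
  rewrite -NS; apply: eq_bigr => x _; have [_ /(_ [::])] := fP x.
  by rewrite sec_nil => ->.
have [|g Gg gE] := @realizable_sum_mod4 d d_ge3 d_odd f Gf.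
  by rewrite sumf (@dvdz_mul 2 2).
have secg x : sec g [:: x] = f x.
  by apply: sec_unique => v; rewrite !gE tree_aut_nil.
exists g => //; split=> [[|x u] uk|[|x u] uk].
- exact: tree_aut_nil.
- by rewrite gE; have [-> ] := fP x.
- have := sum_expo_sec d_ge3 [::] Gg; rewrite sec_nil.
  by under eq_bigr do rewrite secg; rewrite sumf; lia.
- by rewrite -cat1s sec_cat secg; have [_ ->] := fP x.
Qed.

End LevelRist.

(** * The rigid kernel *)

Lemma intr_Zp_eq n (a b : int) : 1 < n ->
  (a%:~R == b%:~R :> 'Z_n)%R = (n %| (a - b)%R)%Z.
Proof.
move=> n_gt1; have natr_Zp_eq0 k : (k%:R == 0 :> 'Z_n)%R = (n %| k).
  by rewrite -val_eqE /= val_Zp_nat.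
rewrite -subr_eq0 -rmorphB /=; case: (a - b)%R => k; first exact: natr_Zp_eq0.
by rewrite NegzE mulrNz oppr_eq0 -pmulrn natr_Zp_eq0 dvdzE abszN.
Qed.

(** For even n, this is n / 2 modulo 2^(k+1), and it determines n modulo
    2^(k+2). *)
Definition half_Zp k (n : int) : 'Z_(2 ^ k.+1) := ((n %/ 2)%Z%:~R)%R.

Lemma half_ZpD k (m n : int) : (2 %| m)%Z -> (2 %| n)%Z ->
  half_Zp k (m + n)%R = (half_Zp k m + half_Zp k n)%R.
Proof. by move=> m2 n2; rewrite /half_Zp divzDl // rmorphD. Qed.

Lemma half_Zp_eq k (m n : int) : (2 %| m)%Z -> (2 %| n)%Z ->
  (half_Zp k m == half_Zp k n) = (2 ^+ k.+2 %| (m - n)%R)%Z.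
Proof.
move=> /dvdzP[m' ->] /dvdzP[n' ->].
rewrite /half_Zp !mulzK // intr_Zp_eq ?(@ltn_exp2l 2 0) // -mulrBl.
by rewrite exprSr dvdz_mul2r // -[Posz _]natz natrX.
Qed.

Section Index.

Variable d : nat.
Variable x0 : 'I_d.

Definition free_index k := {p : (k.-tuple 'I_d * 'I_d)%type | p.2 != x0}.

Lemma card_free_index k : (d ^ k.+1 - d ^ k)%N = #|{: free_index k}|.
Proof.
rewrite card_sig.
have -> : #|[pred p : (k.-tuple 'I_d * 'I_d)%type | p.2 != x0]| =
    #|setX [set: k.-tuple 'I_d] (~: [set x0])|.
  by apply: eq_card => -[t x]; rewrite !inE.
rewrite cardsX cardsT card_tuple card_ord cardsC1 card_ord expnSr.
by rewrite -{2}[(d ^ k)%N]muln1 -mulnBr subn1.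
Qed.

(** The letter x0 marks, among the children of a vertex, the one whose value is
    determined by those of the others. *)
Definition free_vertex k (i : 'I_(d ^ k.+1 - d ^ k)) : word d :=
  let p := val (enum_val (cast_ord (card_free_index k) i) : free_index k) in
  rcons p.1 p.2.

Lemma free_vertex_inj k : injective (@free_vertex k).
Proof.
move=> i j; rewrite /free_vertex => /rcons_inj[e1 e2].
apply/(cast_ord_inj (eq_n := card_free_index k))/enum_val_inj/val_inj.
rewrite [LHS]surjective_pairing [RHS]surjective_pairing e2; congr (_, _).
exact: val_inj.
Qed.

Lemma free_vertexE k (i : 'I_(d ^ k.+1 - d ^ k)) :
  exists v x, [/\ free_vertex i = rcons v x, size v = k & x != x0].
Proof.
rewrite /free_vertex; case: (enum_val _) => -[t x] /= tx.
by exists t, x; rewrite size_tuple.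
Qed.

Lemma size_free_vertex k (i : 'I_(d ^ k.+1 - d ^ k)) :
  size (free_vertex i) = k.+1.
Proof. by have [v [x [-> <- _]]] := free_vertexE i; rewrite size_rcons. Qed.

Lemma free_vertex_surj k v x : size v = k -> x != x0 ->
  exists i, @free_vertex k i = rcons v x.
Proof.
move=> vk xx0; pose t : k.-tuple 'I_d := tcast vk (in_tuple v).
pose p : free_index k := exist _ (t, x) xx0.
exists (cast_ord (esym (card_free_index k)) (enum_rank p)).
by rewrite /free_vertex cast_ordKV enum_rankK /= val_tcast.
Qed.

End Index.

Section RigidKernel.

Variable d : nat.
Hypothesis d_ge3 : 3 <= d.
Hypothesis d_odd : odd d.
Variable x0 : 'I_d.

Local Notation G := (subg (@Gd d)).
Local Notation K := (rigid_kernel (@Gd d)).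
Implicit Types (g h : G) (u v w : word d) (x y : 'I_d) (a b : K).

(** The component of index k of the limits concerns level k + 1. *)
Definition coset_rep a k : G := repr (val (val a) k).

Lemma coset_rep_stab a k : coset_rep a k \in level_stab k.+1.
Proof.
have /eqP/(congr1 val)/(congr1 (fun z => z k)) := valP a.
move=> /eqP; rewrite [val _ k]/= /quot_map [X in _ == X]/= quot_eqE.
by rewrite mulg1 gpredV.
Qed.

Lemma coset_rep_coherent a k :
  (coset_rep a k.+1)^-1 * coset_rep a k \in level_rist k.+1.
Proof.
have /asboolP/(_ k) := valP (val a).
by rewrite /= /quot_map -[X in _ = X]reprK => /eqP; rewrite quot_eqE.
Qed.

Lemma coset_repM a b k :
  (coset_rep (a * b) k)^-1 * (coset_rep a k * coset_rep b k)
    \in level_rist k.+1.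
Proof.
have valM_kernel : val (a * b) = val a * val b by reflexivity.
have valM_limit (x y : rist_completion (@Gd d)) : val (x * y) = val x * val y.
  by reflexivity.
have evalM (x y : prodg (rist_quot (@Gd d))) : (x * y) k = x k * y k.
  by reflexivity.
rewrite -gpredV invgM invgK /coset_rep valM_kernel valM_limit evalM.
exact: repr_piP.
Qed.

Lemma coset_rep_eq a b :
  (forall k, (coset_rep a k)^-1 * coset_rep b k \in level_rist k.+1) -> a = b.
Proof.
move=> ab; do 2!apply: val_inj; apply: functional_extensionality_dep => k.
have := ab k; rewrite -quot_eqE => /eqP.
by rewrite !reprK.
Qed.

Lemma level_rist_congrP k g h :
  g \in level_stab k.+1 -> h \in level_stab k.+1 ->
  reflect
    (forall u, size u = k.+1 -> (2 ^+ k.+2 %| (sexpo g u - sexpo h u)%R)%Z)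
          (g^-1 * h \in level_rist k.+1).
Proof.
move=> gk hk; have [/level_stabP gf /level_stabP hf] := (gk, hk).
have exE u : size u = k.+1 ->
    sexpo (g^-1 * h) u = (- (sexpo g u - sexpo h u))%R.
  move=> uk; have gVu : val g^-1 u = u.
    by have /level_stabP -> // : g^-1 \in level_stab k.+1; rewrite gpredV.
  by rewrite sexpoM // sexpoV ?gf // opprB addrC.
apply: (iffP idP) => [/(level_ristP d_ge3 d_odd)[_ e] u uk | e].
  by rewrite -rpredN -exE ?e.
apply/(level_ristP d_ge3 d_odd); split=> [|u uk]; last first.
  by rewrite exE ?rpredN ?e.
by rewrite gpredM ?gpredV.
Qed.

Local Notation coordinates :=
  (prodg (fun k => {ffun 'I_(d ^ k.+1 - d ^ k) -> 'Z_(2 ^ k.+1)})).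

Definition coord a : coordinates :=
  fun k => [ffun i => half_Zp k (sexpo (coset_rep a k) (free_vertex x0 i))].

Lemma coset_rep_coherent_sexpo a k u : size u = k.+1 ->
  (2 ^+ k.+2 %| (sexpo (coset_rep a k.+1) u - sexpo (coset_rep a k) u)%R)%Z.
Proof.
have stab := level_stabS (coset_rep_stab a k.+1).
have := coset_rep_coherent a k.
by move=> /(level_rist_congrP stab (coset_rep_stab a k)); apply.
Qed.

(** An element of the stabilizer of level k + 1 may have odd exponent sums at
    that level; but here it is congruent to an element stabilizing level k +
    2. *)
Lemma sexpo_coset_rep_even a k u :
  size u = k.+1 -> (2 %| sexpo (coset_rep a k) u)%Z.
Proof.
move=> uk; set e := sexpo _ u.
have e'2 : (2 %| sexpo (coset_rep a k.+1) u)%Z.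
  by rewrite (sexpo_even d_ge3 (coset_rep_stab a k.+1)) ?uk.
have e'e : (2 %| (sexpo (coset_rep a k.+1) u - e)%R)%Z.
  by apply: dvdz_trans (coset_rep_coherent_sexpo a uk); rewrite exprS dvdz_mulr.
by rewrite -[e](subKr (sexpo (coset_rep a k.+1) u)) rpredB.
Qed.

Lemma coord_mul : {morph coord : a b / a * b}.
Proof.
move=> a b; apply: functional_extensionality_dep => k; apply/ffunP => i.
have prodE (x y : coordinates) : (x * y) k i = (x k i + y k i)%R.
  by rewrite [(x * y) k]/(x k * y k) ffunE.
rewrite prodE !ffunE; set u := free_vertex x0 i.
have uk : size u = k.+1 by exact: size_free_vertex.
rewrite -half_ZpD ?sexpo_coset_rep_even //; apply/eqP.
have ab2 : (2 %| (sexpo (coset_rep a k) u + sexpo (coset_rep b k) u)%R)%Z.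
  by rewrite rpredD ?sexpo_coset_rep_even.
rewrite half_Zp_eq ?sexpo_coset_rep_even //.
have abk : coset_rep a k * coset_rep b k \in level_stab k.+1.
  by rewrite gpredM ?coset_rep_stab.
have /(level_rist_congrP (coset_rep_stab _ k) abk)/(_ u uk) := coset_repM a b k.
by have /level_stabP au := coset_rep_stab a k; rewrite sexpoM ?au //.
Qed.

(** The congruences propagate from a vertex to its children: the coordinates
    give those at the children other than the one with last letter x0, and the
    sum rule gives the last one. *)
Lemma coord_inj : injective coord.
Proof.
move=> a b ab; apply: coset_rep_eq => k.
apply/(level_rist_congrP (coset_rep_stab a k) (coset_rep_stab b k)).
pose D j u : int := (sexpo (coset_rep a j) u - sexpo (coset_rep b j) u)%R.
have step j v : size v = j -> (2 ^+ j.+1 %| D j v)%Z ->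
    forall x, (2 ^+ j.+2 %| D j (rcons v x))%Z.
  move=> vj Dv; have D_other x : x != x0 -> (2 ^+ j.+2 %| D j (rcons v x))%Z.
    move=> xx0; have [i iE] := free_vertex_surj vj xx0.
    have : coord a j = coord b j by rewrite ab.
    move=> /ffunP/(_ i); rewrite !ffunE iE => /eqP.
    by rewrite half_Zp_eq ?sexpo_coset_rep_even ?size_rcons ?vj.
  move=> x; have [-> | /D_other//] := eqVneq x x0.
  have : (\sum_x D j (rcons v x) = 2 * D j v)%R.
    by rewrite /D sumrB !sum_sexpo // mulrBr.
  rewrite (bigD1 x0) //= => /(canRL (addrK _))->.
  by rewrite rpredB ?rpred_sum // exprS dvdz_mul.
rewrite -/(D k); elim: k => [|k IHk] u.
  case/lastP: u => // v x; rewrite size_rcons => -[v0]; apply: step => //.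
  by rewrite /D rpredB // (sexpo_even d_ge3 (coset_rep_stab _ 0)) ?v0.
case/lastP: u => // v x; rewrite size_rcons => -[vk]; apply: step => //.
have -> : D k.+1 v = (D k v +
                      (sexpo (coset_rep a k.+1) v - sexpo (coset_rep a k) v) -
                      (sexpo (coset_rep b k.+1) v - sexpo (coset_rep b k) v))%R.
  by rewrite /D; ring.
apply: rpredB; last exact: coset_rep_coherent_sexpo.
by apply: rpredD; [exact: IHk | exact: coset_rep_coherent_sexpo].
Qed.

(** The values m_u are built from the root as integers, with lifts of the
    prescribed residues at the free vertices and the remaining child adjusted
    so that the children of v sum to 2 m_v. Being exact, they fit all levels at
    once, so the elements that realize them at the different levels are
    coherent. *)
Lemma coord_surj c : exists a, coord a = c.
Proof.
pose free_at k u : int :=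
  if [pick i | @free_vertex _ x0 k i == u] is Some i then (c k i : nat) else 0.
pose free u := free_at (size u).-1 u.
have freeE k i : free (@free_vertex _ x0 k i) = c k i.
  rewrite /free size_free_vertex /free_at.
  case: pickP => [j /eqP/free_vertex_inj->//|].
  by move=> /(_ i); rewrite eqxx.
pose others v : int := (\sum_(x | x != x0) free (rcons v x))%R.
(* The recursion runs on the reversed word, from the last letter to the root. *)
pose fix M' (r : word d) : int := if r is x :: r' then
  if x == x0 then (2 * M' r' - others (rev r'))%R else free (rev r) else 0%R.
pose N u : int := (2 * M' (rev u))%R.
have MS v x : M' (rev (rcons v x)) =
    if x == x0 then (2 * M' (rev v) - others v)%R else free (rcons v x).
  by rewrite rev_rcons /= revK rev_cons revK.
have N2 u : (2 %| N u)%Z by rewrite dvdz_mulr.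
have NS v : (\sum_x N (rcons v x) = 2 * N v)%R.
  rewrite -big_distrr /=; congr (_ * _)%R.
  rewrite (bigD1 x0) //= MS eqxx.
  under eq_bigr => x /negPf xx0 do rewrite MS xx0.
  by rewrite subrK.
have [g gP] := choice (fun k =>
  let: ex_intro2 h hk hN := exists_exponents d_ge3 d_odd k.+1 N2 NS in
  ex_intro (fun h => h \in level_stab k.+1 /\
                     forall u, size u <= k.+1 -> sexpo h u = N u)
    h (conj hk hN)).
have gstab k : g k \in level_stab k.+1 by have [] := gP k.
have gN k u : size u <= k.+1 -> sexpo (g k) u = N u by have [_] := gP k; apply.
pose p : prodg (rist_quot (@Gd d)) :=
  fun k => \pi_(quot (level_rist k.+1)) (g k).
have p_coh : p \in coherent (@rist_step d (@Gd d)).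
  apply/asboolP => k; rewrite /p /= quot_mapE; apply/eqP; rewrite quot_eqE.
  apply/(level_rist_congrP (level_stabS (gstab k.+1)) (gstab k)) => u uk.
  by rewrite !gN ?uk ?subrr.
pose q : rist_completion (@Gd d) := Subg p_coh.
have q_ker : q \in kernel (completion_map (@Gd d)).
  apply/eqP/val_inj/functional_extensionality_dep => k.
  rewrite /= quot_mapE; apply/eqP; rewrite quot_eqE mulg1 gpredV //.
exists (Subg q_ker).
apply: functional_extensionality_dep => k; apply/ffunP => i.
rewrite ffunE; set a := Subg _.
have uk : size (free_vertex x0 i) = k.+1 by exact: (@size_free_vertex _ x0 k i).
have [v [x [iE vk xx0]]] := @free_vertexE _ x0 k i.
have Ni : N (free_vertex x0 i) = (2 * (c k i : nat)%:Z)%R.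
  by rewrite /N iE MS (negPf xx0) -iE freeE.
have -> : c k i = half_Zp k (N (free_vertex x0 i)).
  by rewrite Ni /half_Zp mulKz // -pmulrn natr_Zp.
apply/eqP; rewrite half_Zp_eq ?sexpo_coset_rep_even // -(gN k) ?uk //.
rewrite -opprB rpredN.
have /(level_rist_congrP (gstab k) (coset_rep_stab a k)) :
  (g k)^-1 * coset_rep a k \in level_rist k.+1 by exact: repr_piP.
exact.
Qed.

Lemma coord_bij : bijective coord.
Proof.
have [f fK] := choice coord_surj.
by exists f => // a; apply: coord_inj; rewrite fK.
Qed.

End RigidKernel.

Local Close Scope quotient_scope.
Local Close Scope group_scope.

Theorem theorem5p2 (d : nat) (hd : 3 <= d) (hodd : odd d) :
  isomorphic (rigid_kernel (@Gd d))
    (prodg (fun k : nat => {ffun 'I_(d ^ k.+1 - d ^ k) -> 'Z_(2 ^ k.+1)})).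
Proof.
have x0 : 'I_d by exists 0; lia.
pose f := HB.pack_for {multiplicative rigid_kernel (@Gd d) -> prodg _}
  (coord x0) (isMultiplicative.Build _ _ (coord x0) (coord_mul hd hodd x0)).
by exists f; apply: coord_bij.
Qed.
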